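(* Let $L\in(0,\infty]$ and let $\|\cdot\|_{X(0,L)}$ be a rearrangement-invariant function norm on $(0,L)$. Let $\nu\colon(0,L)\to(0,L)$ be an increasing bijection. Let $u\colon(0,L)\to(0,\infty)$ be a nondegenerate nonincreasing function; if $L<\infty$, assume that $u(L^-)>0$. Let $v\colon(0,L)\to(0,\infty)$ be measurable. Set $$\xi(t)=\begin{cases}v(t)U(\nu^{-1}(t)),\ t\in(0,L), &\text{if } L<\infty,\\ v(t)U(\nu^{-1}(t))\chi_{(0,1)}(t)+v(t)\chi_{(1,\infty)}(t),\ t\in(0,\infty),&\text{if } L=\infty.\end{cases}$$ Assume that $\xi\in X'(0,L)$. Let $\|\cdot\|_{Y(0,L)}$ be the rearrangement-invariant function norm whose associate function norm $\|\cdot\|_{Y'(0,L)}$ is defined as $$\|f\|_{Y'(0,L)}=\Big\|v(t)\int_0^{\nu^{-1}(t)}f^*(s)u(s)\,ds\Big\|_{X'(0,L)},\quad f\in\mathfrak{M}^+(0,L).$$ Then the rearrangement-invariant function space $Y(0,L)$ is the optimal target space for the operator $H_{u,v,\nu}$ and $X(0,L)$. Moreover, if $\xi\notin X'(0,L)$, then there is no rearrangement-invariant function space $Z(0,L)$ such that $H_{u,v,\nu}\colon X(0,L)\to Z(0,L)$ is bounded.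
   Context: Conventions: $\frac1\infty=0\cdot\infty=0$. $\mathfrak{M}(0,L)$ is the set of (Lebesgue) measurable functions on $(0,L)$ with values in $[-\infty,\infty]$, and $\mathfrak{M}^+(0,L)$ is the subset of those that are nonnegative a.e. For $f\in\mathfrak M(0,L)$, $f^*(t)=\inf\{\lambda\in(0,\infty):|\{s\in(0,L):|f(s)|>\lambda\}|\le t\}$, $t\in(0,\infty)$, is its nonincreasing rearrangement. Functions $f,g$ are equimeasurable, $f\sim g$, if $|\{|f|>\lambda\}|=|\{|g|>\lambda\}|$ for every $\lambda\in(0,\infty)$. A rearrangement-invariant function norm on $(0,L)$ is a functional $\|\cdot\|_{X(0,L)}\colon\mathfrak{M}^+(0,L)\to[0,\infty]$ such that, for all $f,g,f_k\in\mathfrak M^+(0,L)$ and $\lambda\in[0,\infty)$: (P1) $\|f\|=0$ iff $f=0$ a.e., $\|\lambda f\|=\lambda\|f\|$, $\|f+g\|\le\|f\|+\|g\|$; (P2) $f\le g$ a.e. implies $\|f\|\le\|g\|$; (P3) $f_k\nearrow f$ a.e. implies $\|f_k\|\nearrow\|f\|$; (P4) $\|\chi_E\|<\infty$ for every measurable $E$ of finite measure; (P5) for every measurable $E$ of finite measure there is a finite constant $C_E>0$ with $\int_E f\le C_E\|f\|$ for all $f$; (P6) $\|f\|=\|g\|$ whenever $f\sim g$. It is extended to $\mathfrak M(0,L)$ by $\|f\|=\|\,|f|\,\|$, and $X(0,L)=\{f\in\mathfrak M(0,L):\|f\|_{X(0,L)}<\infty\}$ is the induced rearrangement-invariant function space.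 The associate function norm is $\|f\|_{X'(0,L)}=\sup\{\int_0^Lf(t)g(t)\,dt: g\in\mathfrak M^+(0,L),\|g\|_{X(0,L)}\le1\}$, $f\in\mathfrak M^+(0,L)$; it is again a rearrangement-invariant function norm and $(X')'=X$ with equality of norms, so a rearrangement-invariant function norm is uniquely determined by its associate norm. $X(0,L)\hookrightarrow Y(0,L)$ means that there is $C>0$ with $\|f\|_{Y(0,L)}\le C\|f\|_{X(0,L)}$ for all $f\in\mathfrak M(0,L)$. $U(t)=\int_0^tu(s)\,ds$; $u$ is nondegenerate if $0<U(t_0)<\infty$ for some $t_0\in(0,L)$. $u(L^-)$ is the left limit at $L$. The operator is $H_{u,v,\nu}g(t)=u(t)\int_{\nu(t)}^L|g(s)|v(s)\,ds$, $t\in(0,L)$, $g\in\mathfrak M(0,L)$. An operator $T$ is bounded from $X(0,L)$ to $Y(0,L)$ if $\|Tf\|_{Y(0,L)}\le C\|f\|_{X(0,L)}$ for some $C$ and all $f$. A rearrangement-invariant function space $Y(0,L)$ is the optimal target space for $T$ and $X(0,L)$ if $T\colon X(0,L)\to Y(0,L)$ is bounded and $Y(0,L)\hookrightarrow Z(0,L)$ whenever $Z(0,L)$ is a rearrangement-invariant function space such that $T\colon X(0,L)\to Z(0,L)$ is bounded. *)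

(* Defs.v *)
From HB Require Import structures.
From mathcomp Require Import all_boot all_order all_algebra.
From mathcomp Require Import all_classical all_reals all_analysis.
From mathcomp Require Import measurable_realfun.
Set Implicit Arguments.
Unset Strict Implicit.
Unset Printing Implicit Defensive.
Import Order.TTheory GRing.Theory Num.Theory.
Import numFieldNormedType.Exports.
Local Open Scope classical_set_scope.
Local Open Scope ring_scope.
Local Open Scope ereal_scope.

(* The real line with the sigma-algebra of Lebesgue (not merely Borel)
   measurable sets, obtained in the library as Caratheodory-measurable sets. *)
Notation lebesgueType R := (caratheodory_type ((wlength (@idfun R))^*)%mu).

Notation leb := completed_lebesgue_measure.

(* The open interval (a, L), where L may be +oo. Functions on (0, L) are
   represented by total functions on R whose values off (0, L) are irrelevant. *)
Definition oitv (R : realType) (a : R) (L : \bar R) : set R :=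
  [set x : R | a%:E < x%:E < L].

Definition mfuns (R : realType) (L : \bar R)
    (f : lebesgueType R -> \bar R) : Prop :=
  measurable_fun (oitv 0 L : set (lebesgueType R)) f.

Definition mfuns_ge0 (R : realType) (L : \bar R)
    (f : lebesgueType R -> \bar R) : Prop :=
  mfuns L f /\ \forall t \ae @leb R, oitv 0 L t -> 0 <= f t.

(* The distribution function of f; f itself may take infinite values. *)
Definition distr_fun (R : realType) (L : \bar R)
    (f : lebesgueType R -> \bar R) (l : R) : \bar R :=
  leb (oitv 0 L `&` [set s | l%:E < `|f s|]).

Definition rearr (R : realType) (L : \bar R)
    (f : lebesgueType R -> \bar R) (t : R) : \bar R :=
  ereal_inf [set l%:E | l in [set l : R | (0 < l)%R /\
                                           distr_fun L f l <= t%:E]].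

Definition equimeasurable (R : realType) (L : \bar R)
    (f g : lebesgueType R -> \bar R) : Prop :=
  forall l : R, (0 < l)%R -> distr_fun L f l = distr_fun L g l.

(* The functional N matters only on nonnegative measurable functions on (0, L);
   by rin_le its value there depends only on the restriction to (0, L). *)
Record ri_norm (R : realType) (L : \bar R)
    (N : (lebesgueType R -> \bar R) -> \bar R) : Prop := {
  rin_ge0 : forall f, mfuns_ge0 L f -> 0 <= N f ;
  rin_eq0 : forall f, mfuns_ge0 L f ->
    (N f = 0 <-> \forall t \ae @leb R, oitv 0 L t -> f t = 0) ;
  rin_scale : forall (l : R) f, (0 <= l)%R -> mfuns_ge0 L f ->
    N (fun t => l%:E * f t) = l%:E * N f ;
  rin_triangle : forall f g, mfuns_ge0 L f -> mfuns_ge0 L g ->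
    N (fun t => f t + g t) <= N f + N g ;
  rin_le : forall f g, mfuns_ge0 L f -> mfuns_ge0 L g ->
    (\forall t \ae @leb R, oitv 0 L t -> f t <= g t) -> N f <= N g ;
  rin_fatou : forall (f_ : nat -> lebesgueType R -> \bar R) f,
    (forall k, mfuns_ge0 L (f_ k)) -> mfuns_ge0 L f ->
    (\forall t \ae @leb R, oitv 0 L t ->
       (forall m n, (m <= n)%N -> f_ m t <= f_ n t) /\
       f_ k t @[k --> \oo] --> f t) ->
    (forall m n, (m <= n)%N -> N (f_ m) <= N (f_ n)) /\
    N (f_ k) @[k --> \oo] --> N f ;
  rin_indic_fin : forall E : set (lebesgueType R),
    measurable E -> E `<=` oitv 0 L -> leb E < +oo ->
    N (fun t => (\1_E t)%:E) < +oo ;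
  rin_loc_int : forall E : set (lebesgueType R),
    measurable E -> E `<=` oitv 0 L -> leb E < +oo ->
    exists2 C : R, (0 < C)%R &
      forall f, mfuns_ge0 L f -> \int[leb]_(t in E) f t <= C%:E * N f ;
  rin_equi : forall f g, mfuns_ge0 L f -> mfuns_ge0 L g ->
    equimeasurable L f g -> N f = N g }.

Definition ext_norm (R : realType)
    (N : (lebesgueType R -> \bar R) -> \bar R)
    (f : lebesgueType R -> \bar R) : \bar R :=
  N (fun t => `|f t|).

Definition in_space (R : realType) (L : \bar R)
    (N : (lebesgueType R -> \bar R) -> \bar R)
    (f : lebesgueType R -> \bar R) : Prop :=
  mfuns L f /\ ext_norm N f < +oo.

Definition assoc_norm (R : realType) (L : \bar R)
    (N : (lebesgueType R -> \bar R) -> \bar R)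
    (f : lebesgueType R -> \bar R) : \bar R :=
  ereal_sup [set \int[leb]_(t in (oitv 0 L : set (lebesgueType R)))
                    (f t * g t)
            | g in [set g | mfuns_ge0 L g /\ N g <= 1]].

Definition embedded (R : realType) (L : \bar R)
    (NX NY : (lebesgueType R -> \bar R) -> \bar R) : Prop :=
  exists2 C : R, (0 < C)%R &
    forall f, mfuns L f -> ext_norm NY f <= C%:E * ext_norm NX f.

Definition bounded_op (R : realType) (L : \bar R)
    (T : (lebesgueType R -> \bar R) -> lebesgueType R -> \bar R)
    (NX NY : (lebesgueType R -> \bar R) -> \bar R) : Prop :=
  exists2 C : R, (0 < C)%R &
    forall f, mfuns L f -> ext_norm NY (T f) <= C%:E * ext_norm NX f.

Definition optimal_target (R : realType) (L : \bar R)
    (T : (lebesgueType R -> \bar R) -> lebesgueType R -> \bar R)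
    (NX NY : (lebesgueType R -> \bar R) -> \bar R) : Prop :=
  [/\ ri_norm L NY,
      bounded_op L T NX NY &
      forall NZ, ri_norm L NZ -> bounded_op L T NX NZ -> embedded L NY NZ].

Definition weight_int (R : realType) (u : R -> R) (t : R) : \bar R :=
  \int[leb]_(s in (`]0%R, t[%classic : set (lebesgueType R))) (u s)%:E.

Definition nondeg_weight (R : realType) (L : \bar R) (u : R -> R) : Prop :=
  exists2 t0, oitv 0 L t0 & 0 < weight_int u t0 < +oo.

Definition Hop (R : realType) (L : \bar R) (u v nu : R -> R)
    (g : lebesgueType R -> \bar R) (t : lebesgueType R) : \bar R :=
  (u t)%:E * \int[leb]_(s in (oitv (nu t) L : set (lebesgueType R)))
                (`|g s| * (v s)%:E).

(* pinv (oitv 0 L) nu is the inverse on (0, L) of nu : (0, L) -> (0, L). *)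
Definition xi (R : realType) (L : \bar R) (u v nu : R -> R)
    (t : lebesgueType R) : \bar R :=
  let w := (v t)%:E * weight_int u (pinv (oitv 0 L) nu t) in
  if L == +oo then w * (\1_(`]0%R, 1%R[%classic : set R) t)%:E
                   + (v t * \1_(`]1%R, +oo[%classic : set R) t)%:E
  else w.

Definition target_assoc_norm (R : realType) (L : \bar R) (u v nu : R -> R)
    (NX : (lebesgueType R -> \bar R) -> \bar R)
    (f : lebesgueType R -> \bar R) : \bar R :=
  assoc_norm L NX (fun t => (v t)%:E *
    \int[leb]_(s in (`]0%R, pinv (oitv 0 L) nu t[%classic
                       : set (lebesgueType R)))
       (rearr L f s * (u s)%:E)).

(* Main.v *)
(** Fubini's theorem turns the defining functional of Y' into
      f |-> sup { int f^* (H g) : N_X(g) <= 1 },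
    where H g is nonincreasing. By the Hardy-Littlewood inequality and the
    nonatomicity of Lebesgue measure this is the support functional
      f |-> sup { int f h : h in S },
    where S consists of the h >= 0 whose distribution function is dominated by
    that of some H g with N_X(g) <= 1. Support functionals of rearrangement-
    invariant solid sets satisfy (P1)-(P6) up to two nondegeneracy conditions,
    which for S amount to xi being in X'; and being a polar, the functional is
    its own second associate, so Y := (Y')' exists. The optimality of Y dualizes
    the boundedness of H from X to Z into Y' <= C Z', and the passage back from
    associate norms to norms is the Lorentz-Luxemburg theorem N <= N''. The
    latter is obtained by projecting in L^2 a bounded f with N(f) > 1 onto the
    convex set {0 <= h <= f, N(h) <= 1}: the difference f - h separates f from
    the unit ball of N because N is a lattice norm. *)
Require Import Defs.
From mathcomp Require Import all_boot all_order all_algebra.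
From mathcomp Require Import all_classical all_reals all_analysis.
From mathcomp Require Import measurable_realfun.
From mathcomp Require Import ring lra.
Set Implicit Arguments.
Unset Strict Implicit.
Unset Printing Implicit Defensive.
Import Order.TTheory GRing.Theory Num.Theory.
Import numFieldNormedType.Exports.
Local Open Scope classical_set_scope.
Local Open Scope ring_scope.

(** * Lebesgue measure on the line *)

Local Open Scope ereal_scope.

(** The triangle inequality is not visible in the formula for Y', because rearrangement is not
    subadditive; it is immediate once the functional is a supremum of integrals against f itself.
    The price is that this supremum has to reach the integral of the two rearrangements. Both are
    compared with the double integral, over levels l, m > 0, of min(d_f(l), d_g(m)), where d is the
    distribution function: pairwise nested superlevel sets give exactly this value, all others at
    most this. Nonatomicity enters as continuity of c -> |B cut by (-oo, c]|, which yields sets of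
    prescribed measure nested with the superlevel sets of f. (P5) for the support functional comes
    from images H g that are bounded below on an initial interval. (P4) is finiteness on indicators:
    for |E| = e the defining function is v(t) U(nu^-1(t)) for small t and v(t) U(e) for large t,
    which explains the two pieces of xi when L = oo. The L^2 projection is carried out among bounded
    functions living on a set of finite measure, where all integrals are real numbers; (P3) then
    gives the general case. *)

Lemma measurable_eindic d (T : measurableType d) (R : realType) (A D : set T) :
  measurable A -> measurable_fun D (fun x => (\1_A x : R)%:E).
Proof. by move=> mA; apply/measurable_EFinP/measurable_indic. Qed.

Section lebesgue_line.
Context (R : realType).
Notation LT := (lebesgueType R).
Implicit Types (A D : set LT) (L : \bar R) (f g : LT -> \bar R).

Lemma measurable_interval (I : set R) : is_interval I -> measurable (I : set LT).
Proof. by move=> iI; apply: sub_caratheodory; exact: is_interval_measurable. Qed.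

Lemma oitv_interval (a : R) L : is_interval (oitv a L).
Proof.
move=> x y /andP[x0 xL] /andP[y0 yL] z /andP[xz zy].
by apply/andP; split; [rewrite (lt_le_trans x0)|rewrite (le_lt_trans _ yL)].
Qed.

Lemma measurable_oitv (a : R) L : measurable (oitv a L : set LT).
Proof. exact/measurable_interval/oitv_interval. Qed.

Lemma oitv_fin (a b : R) : oitv a b%:E = `]a, b[%classic.
Proof. by apply/seteqP; split=> x; rewrite /oitv /= in_itv /= !lte_fin. Qed.

Lemma oitv_pinfty (a : R) : oitv a +oo = `]a, +oo[%classic.
Proof.
by apply/seteqP; split=> x; rewrite /oitv /= in_itv /= lte_fin ltry andbT.
Qed.

Lemma leb_itv (i : interval R) : leb ([set` i] : set LT) =
  if (i.1 : \bar R) < i.2 then (i.2 : \bar R) - i.1 else 0.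
Proof. exact: (@lebesgue_measure_itv R i). Qed.

Lemma leb_oitv L : 0 <= L -> leb (oitv 0 L : set LT) = L.
Proof.
case: L => [r| |]//; last by rewrite oitv_pinfty leb_itv/= ltry oppr0 addye.
rewrite lee_fin oitv_fin leb_itv/= lte_fin oppr0 adde0 => r0.
by case: ltP => // r0'; congr _%:E; apply/eqP; rewrite eq_le r0 r0'.
Qed.

(** The part of [D] where [f] exceeds a given level is again an interval. This is the source of
    measurability for distribution functions, rearrangements and the images under H. *)
Lemma measurable_nonincreasing (D : set R) f : is_interval D ->
  (forall x y, D x -> D y -> (x <= y)%R -> f y <= f x) ->
  measurable_fun (D : set LT) f.
Proof.
move=> iD ndf; apply: (measurability _ (ErealGenOInfty.measurableE R)).
move=> _ [_ [r ->] <-]; apply: measurable_interval => x y.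
rewrite /= !in_itv/= !andbT => -[Dx rx] [Dy ry] z /andP[xz zy].
have Dz : D z by apply: (iD x y) => //; rewrite xz.
by rewrite in_itv/= andbT (lt_le_trans ry)// ndf.
Qed.

Lemma measurable_nondecreasing (D : set R) f : is_interval D ->
  (forall x y, D x -> D y -> (x <= y)%R -> f x <= f y) ->
  measurable_fun (D : set LT) f.
Proof.
move=> iD ndf; apply: (measurability _ (ErealGenOInfty.measurableE R)).
move=> _ [_ [r ->] <-]; apply: measurable_interval => x y.
rewrite /= !in_itv/= !andbT => -[Dx rx] [Dy ry] z /andP[xz zy].
have Dz : D z by apply: (iD x y) => //; rewrite xz.
by rewrite in_itv/= andbT (lt_le_trans rx)// ndf.
Qed.

(** Tonelli on the region 0 < l < f x, weighted by [g]: the section over x is an interval of length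
    f x, which may be infinite. *)
Lemma layer_cake D f g : measurable D ->
  measurable_fun D f -> measurable_fun D g ->
  (forall x, D x -> 0 <= f x) -> (forall x, D x -> 0 <= g x) ->
  \int[leb]_(x in D) (f x * g x) =
  \int[leb]_(l in (oitv 0 +oo : set LT))
    \int[leb]_(x in D `&` [set x | (l : R)%:E < f x]) g x.
Proof.
move=> mD mf mg f0 g0.
pose f1 := f \_ D; pose g1 := g \_ D.
have mf1 : measurable_fun setT f1 by exact/(measurable_restrictT _ _).1.
have mg1 : measurable_fun setT g1 by exact/(measurable_restrictT _ _).1.
have f10 x : 0 <= f1 x by apply: erestrict_ge0.
have g10 x : 0 <= g1 x by apply: erestrict_ge0.
pose W := [set z : LT * LT | 0 < (z.2 : R)%:E < f1 z.1].
have mid : measurable_fun setT (fun z : LT => (z : R)%:E).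
  by apply: measurable_nondecreasing => // x y _ _; rewrite lee_fin.
have mW : measurable W.
  have -> : W = [set z | 0 < (z.2 : R)%:E] `&` [set z | (z.2 : R)%:E < f1 z.1].
    by apply/seteqP; split=> z /=; rewrite /W /=; [move/andP|move=> [-> ->]].
  have mid2 : measurable_fun setT (fun z : LT * LT => (z.2 : R)%:E).
    exact: (measurableT_comp mid measurable_snd).
  apply: measurableI; rewrite -[X in measurable X]setTI; apply: measurable_lte => //.
  exact: (measurableT_comp mf1 measurable_fst).
pose F z := g1 z.1 * (\1_W z)%:E.
have mF : measurable_fun setT F.
  apply: emeasurable_funM; first exact: (measurableT_comp mg1 measurable_fst).
  exact: measurable_eindic.
have F0 z : 0 <= F z by rewrite mule_ge0// lee_fin.
have := @fubini_tonelli _ _ LT LT R leb leb F mF F0.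
have -> : (fun x => \int[leb]_y F (x, y)) = (fun x => f x * g x) \_ D.
  apply/funext => x; rewrite /F /=.
  have WE : (fun y => \1_W (x, y)) = \1_(oitv 0 (f1 x)) :> (LT -> R).
    by apply/funext => y; rewrite !indicE; congr (_%:R); apply/idP/idP;
       rewrite !inE.
  have -> : (fun y => g1 x * (\1_W (x, y))%:E) =
      (fun y => g1 x * (\1_(oitv 0 (f1 x) : set LT) y)%:E).
    by apply/funext => y; rewrite -WE.
  have mO : measurable (oitv 0 (f1 x) : set LT) by exact: measurable_oitv.
  have m1O : measurable_fun setT (fun y : LT => (\1_(oitv 0 (f1 x) : set LT) y : R)%:E).
    exact: measurable_eindic.
  rewrite (@ge0_integralZl _ LT R leb setT measurableT
    (fun y => (\1_(oitv 0 (f1 x) : set LT) y : R)%:E)) //.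
  rewrite integral_indic//.
  rewrite setIT /= leb_oitv// /g1 /f1 !patchE; case: ifPn => _; last by rewrite mule0.
  by rewrite muleC.
rewrite -integral_mkcond => ->.
rewrite [RHS]integral_mkcond; apply: eq_integral => l _.
rewrite [in RHS]patchE; case: ifPn => [|/negP] l0; rewrite inE in l0.
  rewrite [RHS]integral_mkcond; apply: eq_integral => x _.
  rewrite /F patchE/= indicE /g1 patchE.
  have xW : ((x, l) \in W) = (x \in D `&` [set x | l%:E < f x]).
    apply/idP/idP; rewrite !inE /W /f1/= patchE.
      case: ifPn => xD /andP[l0']; last by rewrite ltNge (ltW l0').
      by split=> //; rewrite inE in xD.
    move=> [Dx lf]; rewrite mem_set// lf andbT.
    by move: l0 => /andP[].
  rewrite xW; have [|_] := boolP (x \in D `&` _); last by rewrite mule0.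
  by rewrite inE => -[Dx _]; rewrite mem_set// mule1.
apply: integral0_eq => x _; rewrite /F/= indicE memNset ?mule0//.
by rewrite /W/= => /andP[l0' _]; apply: l0; rewrite /oitv/= l0' ltry.
Qed.

End lebesgue_line.

(** * Distribution functions and rearrangements *)

Section measure_chain.
Context d (T : measurableType d) (R : realType) (mu : {measure set T -> \bar R}).

Lemma measure_bigcup_nondecreasing (F : nat -> set T) :
  (forall n, measurable (F n)) -> {homo F : n m / (n <= m)%N >-> n `<=` m} ->
  mu (\bigcup_n F n) = ereal_sup (range (mu \o F)).
Proof.
move=> mF ndF.
have h1 : (mu \o F) x @[x --> \oo] --> mu (\bigcup_n F n).
  apply: nondecreasing_cvg_mu => //; first exact: bigcup_measurable.
  by move=> m n mn; apply/subsetPset; exact: ndF.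
have h2 : (mu \o F) x @[x --> \oo] --> ereal_sup (range (mu \o F)).
  apply: ereal_nondecreasing_cvgn => m n mn /=.
  by apply: le_measure; rewrite ?inE//; exact: ndF.
by rewrite -(cvg_lim _ h1)// (cvg_lim _ h2).
Qed.

(** The chains below are indexed by an enumeration of levels and so are not sorted by inclusion;
    still, each finite union of members of a chain is one of the members, and continuity from below
    applies. *)
Lemma measure_bigcup_chain_le (F : nat -> set T) (t : \bar R) : 0 <= t ->
  (forall n, measurable (F n)) -> (forall m n, F m `<=` F n \/ F n `<=` F m) ->
  (forall n, mu (F n) <= t) -> mu (\bigcup_n F n) <= t.
Proof.
move=> t0 mF chF Ft.
pose G n := \big[setU/set0]_(i < n.+1) F i.
have mG n : measurable (G n) by apply: bigsetU_measurable => i _.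
rewrite -bigcup_bigsetU_bigcup measure_bigcup_nondecreasing//; last first.
  by move=> m n mn; exact: subset_bigsetU.
apply: ge_ereal_sup => _ [n _ <-] /=.
suff [i Gi] : exists i, G n = F i by rewrite -/(G n) Gi.
elim: n => [|n [i Gi]]; first by exists 0%N; rewrite /G big_ord1.
rewrite /G big_ord_recr/= -/(G n) Gi.
by case: (chF i n.+1) => [/setUidPr ->|/setUidPl ->]; [exists n.+1|exists i].
Qed.

End measure_chain.

Section distribution.
Context (R : realType) (L : \bar R).
Notation LT := (lebesgueType R).
Implicit Types (f g h : LT -> \bar R) (l m t : R).
Notation D := (oitv 0 L : set LT).

Definition superlevel f l : set LT := D `&` [set s | l%:E < `|f s|].

Lemma superlevelE f l : leb (superlevel f l) = distr_fun L f l. Proof. by []. Qed.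

Lemma mfuns_abs f : mfuns L f -> mfuns L (fun s => `|f s|).
Proof.
move=> mf; exact: (measurableT_comp (@abse_measurable R setT) mf).
Qed.

Lemma measurable_superlevel f l : mfuns L f -> measurable (superlevel f l).
Proof.
move=> mf; apply: (@measurable_lte _ LT R _ _ (fun=> l%:E) (fun s => `|f s|)) => //.
- exact: measurable_oitv.
- exact: mfuns_abs.
Qed.

Lemma distr_fun_ge0 f l : 0 <= distr_fun L f l. Proof. exact: measure_ge0. Qed.

Lemma superlevelS f l m : (l <= m)%R -> superlevel f m `<=` superlevel f l.
Proof.
by move=> lm s [Ds ms]; split => //; apply: le_lt_trans ms; rewrite lee_fin.
Qed.

Lemma distr_fun_nonincreasing f l m : mfuns L f -> (l <= m)%R ->
  distr_fun L f m <= distr_fun L f l.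
Proof.
by move=> mf lm; apply: le_measure; rewrite ?inE;
  [exact: measurable_superlevel..|exact: superlevelS].
Qed.

Lemma distr_fun_leL f l : 0 <= L -> mfuns L f -> distr_fun L f l <= L.
Proof.
move=> L0 mf; rewrite -[leRHS](leb_oitv L0); apply: le_measure; rewrite ?inE.
- exact: measurable_superlevel.
- exact: measurable_oitv.
- by move=> s [].
Qed.

(** Right-continuity of the distribution function, in the form that leaves room for a rational level
    above [l]. *)
Lemma distr_fun_gt f l c : mfuns L f -> c < distr_fun L f l ->
  exists2 m, (l < m)%R & c < distr_fun L f m.
Proof.
move=> mf; pose F n := superlevel f (l + n.+1%:R^-1)%R.
have -> : distr_fun L f l = leb (\bigcup_n F n).
  congr (leb _); apply/seteqP; split=> [s [Ds]/= ls|s [n _]]; last first.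
    by apply: superlevelS; rewrite lerDl.
  have [k lk] : exists k : nat, (l + k.+1%:R^-1)%:E < `|f s|.
    move: ls; case: `|f s| => [r| |]//; last by exists 0%N; rewrite ltry.
    rewrite lte_fin -subr_gt0 => /[dup] rl0 /ltr_add_invr[k].
    by rewrite add0r ltrBrDl => lk; exists k; rewrite lte_fin.
  by exists k.
rewrite measure_bigcup_nondecreasing.
- by move=> /ereal_sup_gt[_ [n _ <-] cn]; exists (l + n.+1%:R^-1)%R; rewrite ?ltrDl.
- by move=> n; exact: measurable_superlevel.
- by move=> m n mn; apply: superlevelS; rewrite lerD2l lef_pV2 ?posrE// ler_nat.
Qed.

(** Rearrangement and distribution function are generalized inverses of each other. Level 0 is
    included although the infimum in [rearr] runs over positive levels only, by right-continuity. *)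
Lemma rearr_gt f l t : mfuns L f -> (0 <= l)%R ->
  (l%:E < rearr L f t) = (t%:E < distr_fun L f l).
Proof.
move=> mf l0; apply/idP/idP => [|tl]; last first.
  have [m lm tm] := distr_fun_gt mf tl.
  apply: (@lt_le_trans _ _ m%:E); first by rewrite lte_fin.
  apply: le_ereal_inf_tmp => _ [k [k0 kt] <-]; rewrite lee_fin leNgt.
  apply/negP => km; move: tm; apply/negP; rewrite -leNgt.
  by rewrite (le_trans _ kt)// distr_fun_nonincreasing// ltW.
apply: contraTT; rewrite -!leNgt => lt.
apply/lee_addgt0Pr => e e0; apply: ereal_inf_lbound; exists (l + e)%R => //.
split; first by rewrite ltr_wpDl.
by rewrite (le_trans _ lt)// distr_fun_nonincreasing// lerDl ltW.
Qed.

Lemma rearr_ge0 f t : 0 <= rearr L f t.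
Proof. by apply: le_ereal_inf_tmp => _ [k [/ltW k0 _] <-]; rewrite lee_fin. Qed.

Lemma rearr_nonincreasing f s t : (s <= t)%R -> rearr L f t <= rearr L f s.
Proof.
move=> st; apply: ereal_inf_le_tmp => _ [k [k0 kt] <-]; exists k => //; split => //.
by rewrite (le_trans kt)// lee_fin.
Qed.

Lemma mfuns_nonincreasing f :
  (forall s t, oitv 0 L s -> oitv 0 L t -> (s <= t)%R -> f t <= f s) -> mfuns L f.
Proof. move=> nf; apply: measurable_nonincreasing => //; exact: oitv_interval. Qed.

Lemma mfuns_rearr f : mfuns L (rearr L f).
Proof. by apply: mfuns_nonincreasing => s t _ _; exact: rearr_nonincreasing. Qed.

Lemma distr_fun_rearr f l : 0 <= L -> mfuns L f -> (0 <= l)%R ->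
  distr_fun L (rearr L f) l = distr_fun L f l.
Proof.
move=> L0 mf l0; rewrite -[RHS](leb_oitv (distr_fun_ge0 f l)); congr (leb _).
apply/seteqP; split => [s [/andP[s0 sL]]|s /andP[s0 sl]] /=.
  by rewrite gee0_abs ?rearr_ge0// rearr_gt// => ?; rewrite /oitv/= s0.
rewrite gee0_abs ?rearr_ge0// rearr_gt//; split => //.
by rewrite /oitv/= s0 (lt_le_trans sl)// distr_fun_leL.
Qed.

End distribution.

(** * The Hardy-Littlewood pairing *)

Section pairing.
Context (R : realType) (L : \bar R).
Notation LT := (lebesgueType R).
Implicit Types (f g h phi : LT -> \bar R) (l m t : R).
Notation D := (oitv 0 L : set LT).
Notation P := (oitv 0 +oo : set LT).

(* The integral of f^* g^* over (0, L), written by layers so that it visibly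
   depends on the distribution functions only. *)
Definition rearr_pairing f g : \bar R :=
  \int[leb]_(l in P) \int[leb]_(m in P)
    mine (distr_fun L f l) (distr_fun L g m).

Lemma rearr_pairing_inner_ge0 f g l :
  0 <= \int[leb]_(m in P) mine (distr_fun L f l) (distr_fun L g m).
Proof. by apply: integral_ge0 => m _; rewrite le_min !distr_fun_ge0. Qed.

Lemma measurable_rearr_pairing_body f g l : mfuns L g ->
  measurable_fun P (fun m => mine (distr_fun L f l) (distr_fun L g m)).
Proof.
move=> mg; apply: measurable_nonincreasing; first exact: oitv_interval.
by move=> x y _ _ xy; rewrite le_min2// distr_fun_nonincreasing.
Qed.

Lemma measurable_rearr_pairing_inner f g : mfuns L f -> mfuns L g ->
  measurable_fun P
    (fun l => \int[leb]_(m in P) mine (distr_fun L f l) (distr_fun L g m)).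
Proof.
move=> mf mg; apply: measurable_nonincreasing; first exact: oitv_interval.
move=> x y _ _ xy; apply: ge0_le_integral.
- exact: measurable_oitv.
- by move=> m _; rewrite le_min !distr_fun_ge0.
- exact: measurable_rearr_pairing_body.
- exact: measurable_rearr_pairing_body.
- by move=> m _; rewrite le_min2// distr_fun_nonincreasing.
Qed.

Lemma integral_set_superlevel (A : set LT) g : measurable A -> A `<=` D ->
  mfuns L g ->
  \int[leb]_(x in A) `|g x| =
  \int[leb]_(m in P) leb (A `&` superlevel L g m).
Proof.
move=> mA AD mg.
have mgA : measurable_fun A (fun x => `|g x|).
  by apply: measurable_funS (mfuns_abs mg) => //; exact: measurable_oitv.
transitivity (\int[leb]_(x in A) (`|g x| * cst 1 x)).
  by apply: eq_integral => x _; rewrite mule1.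
rewrite layer_cake//; apply: eq_integral => m _.
have -> : A `&` [set x | m%:E < `|g x|] = A `&` superlevel L g m.
  by apply/seteqP; split => x [Ax gx]; split => //; [split => //; exact: AD|case: gx].
rewrite integral_cst ?mul1e//.
by apply: measurableI => //; exact: measurable_superlevel.
Qed.

Lemma integral_superlevel f g : mfuns L f -> mfuns L g ->
  \int[leb]_(x in D) (`|f x| * `|g x|) =
  \int[leb]_(l in P) \int[leb]_(m in P)
    leb (superlevel L f l `&` superlevel L g m).
Proof.
move=> mf mg.
rewrite (@layer_cake _ D _ _ (measurable_oitv 0 L) (mfuns_abs mf) (mfuns_abs mg));
  [|by move=> x _; exact: abse_ge0..].
apply: eq_integral => l _; apply: integral_set_superlevel mg.
- exact: measurable_superlevel.
- by move=> x [].
Qed.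

(** Layer by layer: an intersection is no larger than the smaller of its two sets. *)
Lemma hardy_littlewood f g : mfuns L f -> mfuns L g ->
  \int[leb]_(x in D) (`|f x| * `|g x|) <= rearr_pairing f g.
Proof.
move=> mf mg; rewrite (integral_superlevel mf mg).
have mI x y : measurable (superlevel L f x `&` superlevel L g y).
  by apply: measurableI => //; exact: measurable_superlevel.
have mb x : measurable_fun P (fun m => leb (superlevel L f x `&` superlevel L g m)).
  apply: measurable_nonincreasing; first exact: oitv_interval.
  move=> y z _ _ yz; apply: le_measure; rewrite ?inE//.
  by apply: setIS; exact: superlevelS.
have leb_min x y : leb (superlevel L f x `&` superlevel L g y) <=
    mine (distr_fun L f x) (distr_fun L g y).
  rewrite le_min; apply/andP; split; apply: le_measure; rewrite ?inE//;
    by [exact: measurable_superlevel|move=> ? []].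
apply: ge0_le_integral; first exact: measurable_oitv.
- by move=> l _; apply: integral_ge0.
- apply: measurable_nonincreasing; first exact: oitv_interval.
  move=> y z _ _ yz; apply: ge0_le_integral => //; first exact: measurable_oitv.
  move=> m _; apply: le_measure; rewrite ?inE//.
  by apply: setSI; exact: superlevelS.
- exact: measurable_rearr_pairing_inner.
- move=> l _; apply: ge0_le_integral.
  + exact: measurable_oitv.
  + by move=> m _; exact: measure_ge0.
  + exact: mb.
  + exact: measurable_rearr_pairing_body.
  + by move=> m _; exact: leb_min.
Qed.

Lemma rearr_pairing_le f g g' : mfuns L f -> mfuns L g -> mfuns L g' ->
  (forall l, (0 < l)%R -> distr_fun L g l <= distr_fun L g' l) ->
  rearr_pairing f g <= rearr_pairing f g'.
Proof.
move=> mf mg mg' gg'; apply: ge0_le_integral; first exact: measurable_oitv.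
- by move=> l _; exact: rearr_pairing_inner_ge0.
- exact: measurable_rearr_pairing_inner.
- exact: measurable_rearr_pairing_inner.
move=> l _; apply: ge0_le_integral.
- exact: measurable_oitv.
- by move=> m _; rewrite le_min !distr_fun_ge0.
- exact: measurable_rearr_pairing_body.
- exact: measurable_rearr_pairing_body.
- by move=> m /andP[m0 _]; rewrite le_min2// gg'.
Qed.

(** Superlevel sets of nonincreasing functions are initial segments of (0, L), hence nested, and
    each intersection has exactly the smaller measure. *)
Lemma rearr_pairing_nonincreasing f phi : 0 <= L -> mfuns L f ->
  (forall s, oitv 0 L s -> 0 <= phi s) ->
  (forall s t, oitv 0 L s -> oitv 0 L t -> (s <= t)%R -> phi t <= phi s) ->
  \int[leb]_(x in D) (rearr L f x * phi x) = rearr_pairing f phi.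
Proof.
move=> L0 mf phi0 ndphi; have mphi := mfuns_nonincreasing ndphi.
have mfs : mfuns L (rearr L f) by exact: mfuns_rearr.
transitivity (\int[leb]_(x in D) (`|rearr L f x| * `|phi x|)).
  by apply: eq_integral => x; rewrite inE => Dx; rewrite !gee0_abs ?phi0 ?rearr_ge0.
rewrite (integral_superlevel mfs mphi); apply: eq_integral => l lP.
apply: eq_integral => m _; have /andP[l0 _] : P l by rewrite inE in lP.
rewrite -(distr_fun_rearr L0 mf (ltW l0)).
have minE (A B : set LT) : measurable A -> measurable B ->
    A `<=` B \/ B `<=` A -> leb (A `&` B) = mine (leb A) (leb B).
  move=> mA mB [] AB.
    by rewrite (setIidl AB) min_l// le_measure// inE.
  by rewrite (setIidr AB) min_r// le_measure// inE.
rewrite minE//; try exact: measurable_superlevel.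
have down f' r x y : (forall s, oitv 0 L s -> 0 <= f' s) ->
    (forall s t, oitv 0 L s -> oitv 0 L t -> (s <= t)%R -> f' t <= f' s) ->
    superlevel L f' r y -> D x -> (x <= y)%R -> superlevel L f' r x.
  move=> f'0 ndf' [Dy /=]; rewrite gee0_abs ?f'0// => ry Dx xy; split => //=.
  by rewrite gee0_abs ?f'0// (lt_le_trans ry)// ndf'.
have [|/existsNP[x /not_implyP[Ax nBx]]] :=
  pselect (superlevel L (rearr L f) l `<=` superlevel L phi m); first by left.
right=> y By; have [Dx _] := Ax; have [Dy _] := By.
have [xy|yx] := leP (x : R) y; first by exfalso; apply: nBx; apply: down By _ xy.
apply: down Ax Dy (ltW yx) => //; first by move=> *; exact: rearr_ge0.
by move=> s t _ _; exact: rearr_nonincreasing.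
Qed.

End pairing.

(** * Sets of prescribed measure nested with a given chain *)

Section chain_interpolation.
Context (R : realType).
Notation LT := (lebesgueType R).

Lemma leb_bounded_lty (k : R) (A : set LT) : measurable A ->
  A `<=` oitv 0 k%:E -> leb A < +oo.
Proof.
move=> mA Ak; apply: (@le_lt_trans _ _ (leb (oitv 0 k%:E : set LT))).
  by apply: le_measure; rewrite ?inE//; exact: measurable_oitv.
by rewrite oitv_fin leb_itv/= oppr0 adde0; case: ifP; rewrite ?ltry.
Qed.

(** As the cut c moves from 0 to k the set grows from [A] to [B], and its measure is 1-Lipschitz in
    c, so the intermediate value theorem applies. *)
Lemma leb_interpolation (k : R) (A B : set LT) (t : R) : (0 <= k)%R ->
  measurable A -> measurable B -> A `<=` B -> B `<=` oitv 0 k%:E ->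
  leb A <= t%:E <= leb B ->
  exists c : R, leb (A `|` (B `&` `]-oo, c]%classic)) = t%:E.
Proof.
move=> k0 mA mB AB Bk /andP[At tB].
pose S (c : R) : set LT := A `|` (B `&` `]-oo, c]%classic).
have mS c : measurable (S c).
  apply: measurableU => //; apply: measurableI => //.
  by apply: measurable_interval; exact: interval_is_interval.
have Slty c : leb (S c) < +oo.
  by apply: (@leb_bounded_lty k _ (mS c)) => x [/AB/Bk //|[/Bk //]].
pose w c := fine (leb (S c)).
have wE c : (w c)%:E = leb (S c) by rewrite fineK// ge0_fin_numE.
have w_nd c c' : (c <= c')%R -> (w c <= w c')%R.
  move=> cc'; rewrite -lee_fin !wE le_measure ?inE//.
  move=> x [Ax|[Bx xc]]; [by left|right; split => //].
  by move: xc; rewrite /= !in_itv/= => /le_trans; apply.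
have w_lip c c' : (c <= c')%R -> (w c' <= w c + (c' - c))%R.
  move=> cc'; rewrite -lee_fin EFinD !wE.
  have mI : measurable (`]c, c']%classic : set LT).
    by apply: measurable_interval; exact: interval_is_interval.
  have -> : (c' - c)%:E = leb (`]c, c']%classic : set LT).
    by rewrite leb_itv/= lte_fin; case: ltP => // c'c; rewrite (@le_anti _ _ c c') ?subrr// cc'.
  apply: (@le_trans _ _ (leb (S c `|` `]c, c']%classic))); last exact: measureU2.
  apply: le_measure; rewrite ?inE//; first exact: measurableU.
  move=> x [Ax|[Bx]]; first by left; left.
  rewrite /= in_itv/= => xc'; have [xc|cx] := leP (x : R) c.
    by left; right; split => //=; rewrite in_itv.
  by right; rewrite /= in_itv/= cx.
have w_cont : continuous w.
  move=> x; apply/cvgrPdist_le => e e0; near=> y.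
  have : (`|x - y| <= e)%R by near: y; apply: cvgr_dist_le.
  have [xy|/ltW yx] := leP x y.
    have := w_lip _ _ xy; have := w_nd _ _ xy; rewrite !ler_norml.
    by move=> ? ? /andP[? ?]; apply/andP; split; lra.
  have := w_lip _ _ yx; have := w_nd _ _ yx; rewrite !ler_norml.
  by move=> ? ? /andP[? ?]; apply/andP; split; lra.
have S0 : S 0%R = A.
  apply/seteqP; split => [x [//|[/Bk/andP[x0 _]]]|x]; last by left.
  by rewrite /= in_itv/= leNgt -lte_fin x0.
have Sk : S k = B.
  apply/seteqP; split => [x [/AB//|[]//]|x Bx]; right; split => //.
  by have /andP[_ xk] := Bk _ Bx; rewrite /= in_itv/= ltW.
have wk : (w 0 <= t <= w k)%R by rewrite -!lee_fin !wE S0 Sk At.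
have [||c _ wc] := @IVT _ w 0 k t k0.
- exact: continuous_subspaceT.
- by rewrite (min_idPl (w_nd _ _ k0)) (max_idPr (w_nd _ _ k0)).
by exists c; rewrite -wc wE.
Unshelve. all: by end_near. Qed.

End chain_interpolation.

Lemma integral_le_sup d (T : measurableType d) (R : realType)
    (mu : {measure set T -> \bar R}) (D : set T) (F : T -> \bar R)
    (F_ : nat -> T -> \bar R) : measurable D ->
  measurable_fun D F -> (forall x, D x -> 0 <= F x) ->
  (forall k, measurable_fun D (F_ k)) -> (forall k x, D x -> 0 <= F_ k x) ->
  (forall x, D x -> {homo F_ ^~ x : m n / (m <= n)%N >-> m <= n}) ->
  (forall x, D x -> F x <= ereal_sup (range (F_ ^~ x))) ->
  \int[mu]_(x in D) F x <= ereal_sup (range (fun k => \int[mu]_(x in D) F_ k x)).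
Proof.
move=> mD mF F0 mF_ F_0 ndF_ FF_.
have nd_int : {homo (fun k => \int[mu]_(x in D) F_ k x) : m n / (m <= n)%N >-> m <= n}.
  move=> m n mn; apply: ge0_le_integral => //; first by move=> x; exact: F_0.
  by move=> x Dx; exact: ndF_.
have <- := cvg_lim (@ereal_hausdorff _) (ereal_nondecreasing_cvgn nd_int).
rewrite -monotone_convergence//.
have limE x : D x -> limn (F_ ^~ x) = ereal_sup (range (F_ ^~ x)).
  move=> Dx; apply: (cvg_lim (@ereal_hausdorff _)).
  by apply: ereal_nondecreasing_cvgn => m n mn; exact: ndF_.
apply: ge0_le_integral => //.
- apply: (@emeasurable_fun_cvg _ _ _ _ F_) => // x Dx.
  by rewrite limE//; apply: ereal_nondecreasing_cvgn => m n mn; exact: ndF_.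
- by move=> x Dx; rewrite limE// FF_.
Qed.

Section nested_sets.
Context (R : realType).
Notation LT := (lebesgueType R).

(* [A t] fills up the union [P_ t] of the members of the chain of measure at most
   t, inside the intersection [Q_ t] of the larger ones, by cutting with a
   half-line. *)
Lemma chain_interpolation (k : R) (E : set LT) (F : nat -> set LT) : (0 <= k)%R ->
  measurable E -> E `<=` oitv 0 k%:E ->
  (forall n, measurable (F n)) -> (forall n, F n `<=` E) ->
  (forall m n, F m `<=` F n \/ F n `<=` F m) ->
  exists A : R -> set LT, forall t : R, (0 <= t)%R -> t%:E <= leb E ->
    [/\ measurable (A t), A t `<=` E, leb (A t) = t%:E,
      forall n, leb (F n) <= t%:E -> F n `<=` A t &
      (forall n, t%:E < leb (F n) -> A t `<=` F n) /\
      (forall s, (0 <= s <= t)%R -> A s `<=` A t)].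
Proof.
move=> k0 mE Ek mF FE chF.
have Elty : leb E < +oo by exact: leb_bounded_lty Ek.
pose P_ t := \bigcup_n (if leb (F n) <= t%:E then F n else set0).
pose N_ t := \bigcup_n (if leb (F n) <= t%:E then set0 else E `\` F n).
pose Q_ t := E `\` N_ t.
have mP t : measurable (P_ t).
  by apply: bigcup_measurable => n _; case: ifP.
have mN t : measurable (N_ t).
  by apply: bigcup_measurable => n _; case: ifP => // _; exact: measurableD.
have mQ t : measurable (Q_ t) by exact: measurableD.
have NE t : N_ t `<=` E by move=> x [n _]; case: ifP => // _ [].
have PE t : P_ t `<=` E by move=> x [n _]; case: ifP => // _; exact: FE.
have PF t n : leb (F n) <= t%:E -> F n `<=` P_ t.
  by move=> Fnt x Fx; exists n => //; rewrite Fnt.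
have QF t n : t%:E < leb (F n) -> Q_ t `<=` F n.
  move=> tFn x [Ex Nx]; apply: contrapT => nFx; apply: Nx; exists n => //.
  by rewrite leNgt tFn.
have PQ t : P_ t `<=` Q_ t.
  move=> x [n _]; case: ifPn => // Fnt Fnx; split; first exact: FE Fnx.
  move=> [m _]; case: ifPn => // Fmt [Ex nFmx].
  have [FF|FF] := chF m n; last by apply: nFmx; exact: FF.
  move: Fmt; apply/negP; rewrite negbK (le_trans _ Fnt)//.
  by apply: le_measure; rewrite ?inE.
have Pt t : (0 <= t)%R -> leb (P_ t) <= t%:E.
  move=> t0; apply: measure_bigcup_chain_le => //.
  - by move=> n; case: ifP.
  - by move=> m n; case: ifP => _; case: ifP => _; by [left|right|exact: chF].
  - by move=> n; case: ifP => // _; rewrite measure0 lee_fin.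
have finE A : measurable A -> A `<=` E -> leb A \is a fin_num.
  move=> mA AE; rewrite ge0_fin_numE//; apply: le_lt_trans Elty.
  by apply: le_measure; rewrite ?inE.
(* Estimated through the complement: the removed sets E \ F n form a chain too, each of measure at
   most |E| - t. *)
have tQ t : (0 <= t)%R -> t%:E <= leb E -> t%:E <= leb (Q_ t).
  move=> t0 tE; have NEt : leb (N_ t) <= leb E - t%:E.
    apply: measure_bigcup_chain_le.
    - by rewrite sube_ge0.
    - by move=> n; case: ifP => // _; exact: measurableD.
    - move=> m n; case: ifP => _; case: ifP => _; try by [left|right].
      by case: (chF m n) => FF; [right|left]; exact: setDS.
    - move=> n; case: ifPn => [_|]; first by rewrite measure0 sube_ge0.
      rewrite -ltNge => tFn; rewrite measureD//.
      by rewrite setIidr// leeB// ltW.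
  rewrite measureD// setIidr//.
  rewrite leeBrDr; last exact: finE (mN t) (@NE t).
  by move: NEt; rewrite leeBrDr// addeC.
have /choice[c Hc] : forall t, exists c : R, (0 <= t)%R -> t%:E <= leb E ->
    leb (P_ t `|` (Q_ t `&` `]-oo, c]%classic)) = t%:E.
  move=> t; have [t0|t0] := leP 0%R t; last by exists 0%R.
  have [tE|tE] := leP t%:E (leb E); last by exists 0%R.
  have [||c cE] := @leb_interpolation R k (P_ t) (Q_ t) t k0 (mP t) (mQ t) (@PQ t).
  - by move=> x [/Ek].
  - by rewrite Pt// tQ.
  - by exists c.
pose A t := P_ t `|` (Q_ t `&` `]-oo, c t]%classic).
have AQ t : A t `<=` Q_ t by move=> x [/PQ|[]].
have mA t : measurable (A t).
  apply: measurableU => //; apply: measurableI => //.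
  by apply: measurable_interval; exact: interval_is_interval.
exists A => t t0 tE; split => //; first by move=> x /AQ[].
- exact: Hc.
- by move=> n Fnt x Fnx; left; exact: PF Fnx.
split; first by move=> n tFn x /AQ; exact: QF.
move=> s /andP[s0 st].
(* A member of the chain with measure in (s, t] separates A s from A t. Without one, [P_] and [Q_]
   are the same for s and t, so the two sets differ only in the cut; if the cuts are in the wrong
   order, comparing measures forces s = t. *)
have [[n sFn Fnt]|noF] := pselect (exists2 n, s%:E < leb (F n) & leb (F n) <= t%:E).
  by move=> x /AQ/(QF _ _ sFn)/(PF _ _ Fnt); left.
have eqF n : (leb (F n) <= s%:E) = (leb (F n) <= t%:E).
  apply/idP/idP => [/le_trans|Fnt]; first by apply; rewrite lee_fin.
  by rewrite leNgt; apply/negP => sFn; apply: noF; exists n.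
have EP : P_ s = P_ t by apply: eq_bigcupr => n _; rewrite eqF.
have EQ : Q_ s = Q_ t.
  by rewrite /Q_; congr (_ `\` _); apply: eq_bigcupr => n _; rewrite eqF.
have [cst|/ltW cts] := leP (c s) (c t).
  rewrite /A EP EQ; apply: setUS; apply: setIS => x; rewrite /= !in_itv/=.
  by move=> /le_trans; apply.
have AA : A t `<=` A s.
  rewrite /A EP EQ; apply: setUS; apply: setIS => x; rewrite /= !in_itv/=.
  by move=> /le_trans; apply.
have ts : (t <= s)%R.
  have sE : s%:E <= leb E by rewrite (le_trans _ tE)// lee_fin.
  rewrite -lee_fin -(Hc _ s0 sE) -(Hc _ t0 tE) -/(A s) -/(A t).
  by apply: le_measure; rewrite ?inE.
by rewrite (@le_anti _ _ s t)// st.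
Qed.

End nested_sets.

(** * Resonance: the pairing is reached by functions dominated in distribution *)

Section rearrangement_resonance.
Context (R : realType) (L : \bar R).
Notation LT := (lebesgueType R).
Implicit Types (f g h phi : LT -> \bar R) (l m t : R).
Notation D := (oitv 0 L : set LT).
Notation P := (oitv 0 +oo : set LT).

(** A countable dense family of levels in [0, oo). Negative rationals are clipped to 0 and indices
    that code no rational are sent to 0, both harmless since level 0 is admissible. *)
Definition rat_enum (n : nat) : R :=
  Num.max 0%R (ratr (odflt 0%R (unpickle n : option rat))).

Lemma rat_enum_ge0 n : (0 <= rat_enum n)%R.
Proof. by rewrite le_max lexx. Qed.

Lemma rat_enum_between (a b : R) : (0 <= a)%R -> (a < b)%R ->
  exists n, (a < rat_enum n)%R /\ (rat_enum n < b)%R.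
Proof.
move=> a0 /rat_in_itvoo[q]; rewrite in_itv/= => /andP[aq qb].
exists (pickle q); rewrite /rat_enum pickleK/= max_r ?aq ?qb//.
by rewrite (le_trans a0)// ltW.
Qed.

(* The superlevel sets of h are nested sets interpolating those of f, with the
   measures of the superlevel sets of g. *)
Lemma resonance_bounded (k : R) f g : (0 <= k)%R -> mfuns L f -> mfuns L g ->
  (forall x, D x -> (k <= x)%R -> f x = 0) ->
  exists h, [/\ mfuns L h, forall x, 0 <= h x,
    forall l, (0 < l)%R -> distr_fun L h l <= distr_fun L g l &
    rearr_pairing L f g <= \int[leb]_(x in D) (`|f x| * `|h x|)].
Proof.
move=> k0 mf mg fk.
pose E : set LT := D `&` oitv 0 k%:E.
have mE : measurable E by apply: measurableI; exact: measurable_oitv.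
have Ek : E `<=` oitv 0 k%:E by move=> x [].
have Elty : leb E < +oo by exact: leb_bounded_lty Ek.
pose F n := superlevel L f (rat_enum n).
have mF n : measurable (F n) by exact: measurable_superlevel.
have FE n : F n `<=` E.
  move=> x [Dx /= fx]; split => //; have /andP[x0 _] := Dx; apply/andP; split => //.
  rewrite lte_fin ltNge; apply/negP => /(fk _ Dx) fx0.
  by move: fx; rewrite fx0 abse0 lte_fin ltNge rat_enum_ge0.
have chF i j : F i `<=` F j \/ F j `<=` F i.
  by have [ij|/ltW ji] := leP (rat_enum i) (rat_enum j); [right|left]; exact: superlevelS.
have [A HA] := chain_interpolation k0 mE Ek mF FE chF.
(* Only sets inside [E] are available, so the desired measure is capped at |E|. As every F n lies in
   [E], the cap loses nothing in a minimum with |F n|. *)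
pose t n := fine (mine (distr_fun L g (rat_enum n)) (leb E)).
have tE n : (t n)%:E = mine (distr_fun L g (rat_enum n)) (leb E).
  rewrite fineK// ge0_fin_numE ?le_min ?distr_fun_ge0 ?measure_ge0//.
  by rewrite gt_min Elty orbT.
have t0 n : (0 <= t n)%R by rewrite -lee_fin tE le_min distr_fun_ge0 measure_ge0.
have tleE n : (t n)%:E <= leb E by rewrite tE ge_min lexx orbT.
have mA n : measurable (A (t n)) by have [] := HA _ (t0 n) (tleE n).
have AE n : A (t n) `<=` E by have [] := HA _ (t0 n) (tleE n).
(* The function is rebuilt from its layers: h is the supremum of q times the indicator of the set
   chosen for level q, and {h > m} is the union of the sets chosen for q > m. *)
pose u n (x : LT) : \bar R := (rat_enum n * \1_(A (t n)) x : R)%:E.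
pose h x := esups (u ^~ x) 0%N.
have hE x : h x = ereal_sup (range (u ^~ x)).
  by rewrite /h /esups /sdrop; congr ereal_sup; apply/seteqP; split => _ [n _ <-]; exists n.
have u0 n x : 0 <= u n x by rewrite lee_fin mulr_ge0// rat_enum_ge0.
have h0 x : 0 <= h x.
  by rewrite hE; apply: (le_trans (u0 0%N x)); apply: ereal_sup_ubound; exists 0%N.
have mu_ n : measurable_fun D (u n).
  by apply/measurable_EFinP; apply: measurable_funM => //; exact: measurable_indic.
have mh : mfuns L h by exact: measurable_fun_esups.
have h_sup m : (0 < m)%R -> superlevel L h m =
    \bigcup_n (if (m < rat_enum n)%R then A (t n) else set0).
  move=> m0; apply/seteqP; split=> [x [Dx /=]|x [n _]].
    rewrite gee0_abs// hE => /ereal_sup_gt[_ [n _ <-]].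
    rewrite lte_fin /u indicE; have [xA|xA] := boolP (x \in A (t n)); last first.
      by rewrite mulr0 ltNge (ltW m0).
    by rewrite mulr1 => mn; exists n => //; rewrite mn; rewrite inE in xA.
  case: ifP => // mn Ax; split; first by have [] := AE _ _ Ax.
  rewrite /= gee0_abs// hE; apply: (@lt_le_trans _ _ (u n x)).
    by rewrite lte_fin indicE mem_set// mulr1.
  by apply: ereal_sup_ubound; exists n.
exists h; split => //.
- move=> l l0; rewrite -superlevelE h_sup//; apply: measure_bigcup_chain_le.
  + exact: distr_fun_ge0.
  + by move=> n; case: ifP.
  + move=> i j; case: ifP => _; case: ifP => _; try by [left|right].
    have [ij|/ltW ji] := leP (t i) (t j); [left|right].
      by have [_ _ _ _ [_]] := HA _ (t0 j) (tleE j); apply; rewrite t0.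
    by have [_ _ _ _ [_]] := HA _ (t0 i) (tleE i); apply; rewrite t0.
  + move=> n; case: ifP => [ln|_]; last by rewrite measure0 distr_fun_ge0.
    have [_ _ At _ _] := HA _ (t0 n) (tleE n).
    change (leb (A (t n)) <= distr_fun L g l); rewrite At.
    by rewrite tE ge_min distr_fun_nonincreasing// ltW.
rewrite (integral_superlevel mf mh).
(* If the intersection were too small, right-continuity would give rational levels slightly above l
   and m at which F i and A (t j) still have larger measure. These two are nested, and the smaller
   one lies in the intersection. *)
have key l m : (0 < l)%R -> (0 < m)%R ->
    mine (distr_fun L f l) (distr_fun L g m) <=
    leb (superlevel L f l `&` superlevel L h m).
  move=> l0 m0; rewrite leNgt; apply/negP; rewrite lt_min => /andP[vf vg].
  set S := superlevel L f l `&` superlevel L h m in vf vg.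
  have mS : measurable S by apply: measurableI; exact: measurable_superlevel.
  have [l' ll' vl'] := distr_fun_gt mf vf; have [m' mm' vm'] := distr_fun_gt mg vg.
  have [i [li il']] := rat_enum_between (ltW l0) ll'.
  have [j [mj jm']] := rat_enum_between (ltW m0) mm'.
  have vFi : leb S < leb (F i).
    by apply: (lt_le_trans vl'); apply: distr_fun_nonincreasing => //; exact: ltW.
  have vt : leb S < (t j)%:E.
    rewrite tE lt_min; apply/andP; split.
      by apply: (lt_le_trans vm'); apply: distr_fun_nonincreasing => //; exact: ltW.
    by apply: (lt_le_trans vFi); apply: le_measure; rewrite ?inE.
  have Fl : F i `<=` superlevel L f l by apply: superlevelS; exact: ltW.
  have Am : A (t j) `<=` superlevel L h m.
    by move=> x Ax; rewrite h_sup//; exists j => //; rewrite mj.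
  have [_ _ At F_A [A_F _]] := HA _ (t0 j) (tleE j).
  have [Fit|tFi] := leP (leb (F i)) (t j)%:E.
    move: vFi; apply/negP; rewrite -leNgt; apply: le_measure; rewrite ?inE//.
    by move=> x Fx; split; [exact: Fl|apply: Am; exact: F_A Fx].
  move: vt; apply/negP; rewrite -leNgt -At; apply: le_measure; rewrite ?inE//.
  by move=> x Ax; split; [apply: Fl; exact: A_F Ax|exact: Am].
have mI x y : measurable (superlevel L f x `&` superlevel L h y).
  by apply: measurableI; exact: measurable_superlevel.
have mb x : measurable_fun P (fun m => leb (superlevel L f x `&` superlevel L h m)).
  apply: measurable_nonincreasing; first exact: oitv_interval.
  move=> y z _ _ yz; apply: le_measure; rewrite ?inE//.
  by apply: setIS; exact: superlevelS.
apply: ge0_le_integral.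
- exact: measurable_oitv.
- by move=> l _; exact: rearr_pairing_inner_ge0.
- exact: measurable_rearr_pairing_inner.
- apply: measurable_nonincreasing; first exact: oitv_interval.
  move=> y z _ _ yz; apply: ge0_le_integral.
  + exact: measurable_oitv.
  + by move=> m _; exact: measure_ge0.
  + exact: mb.
  + exact: mb.
  + move=> m _; apply: le_measure; rewrite ?inE//.
    by apply: setSI; exact: superlevelS.
- move=> l /andP[l_gt0 _]; apply: ge0_le_integral.
  + exact: measurable_oitv.
  + by move=> m _; rewrite le_min !distr_fun_ge0.
  + exact: measurable_rearr_pairing_body.
  + exact: mb.
  + by move=> m /andP[m_gt0 _]; exact: key.
Qed.

Lemma rearr_pairing_le_sup f g (f_ : nat -> LT -> \bar R) : mfuns L f -> mfuns L g ->
  (forall n, mfuns L (f_ n)) ->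
  (forall l, (0 < l)%R -> {homo (fun n => distr_fun L (f_ n) l) : m n / (m <= n)%N >-> m <= n}) ->
  (forall l, (0 < l)%R -> distr_fun L f l <= ereal_sup (range (fun n => distr_fun L (f_ n) l))) ->
  rearr_pairing L f g <= ereal_sup (range (fun n => rearr_pairing L (f_ n) g)).
Proof.
move=> mf mg mf_ nd_ le_; apply: integral_le_sup.
- exact: measurable_oitv.
- exact: measurable_rearr_pairing_inner.
- by move=> l _; exact: rearr_pairing_inner_ge0.
- by move=> n; exact: measurable_rearr_pairing_inner.
- by move=> n l _; exact: rearr_pairing_inner_ge0.
- move=> l /andP[l0 _] m n mn; apply: ge0_le_integral.
  + exact: measurable_oitv.
  + by move=> x _; rewrite le_min !distr_fun_ge0.
  + exact: measurable_rearr_pairing_body.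
  + exact: measurable_rearr_pairing_body.
  + by move=> x _; rewrite le_min2// nd_.
move=> l /andP[l0 _]; apply: integral_le_sup.
- exact: measurable_oitv.
- exact: measurable_rearr_pairing_body.
- by move=> x _; rewrite le_min !distr_fun_ge0.
- by move=> n; exact: measurable_rearr_pairing_body.
- by move=> n x _; rewrite le_min !distr_fun_ge0.
- by move=> x _ m n mn; rewrite le_min2// nd_.
move=> x _; have := le_ _ l0; set s := ereal_sup _ => fs.
rewrite leNgt; apply/negP; rewrite lt_min => /andP[vf vg].
have /ereal_sup_gt[_ [n _ <-] vn] := lt_le_trans vf fs.
have : mine (distr_fun L (f_ n) l) (distr_fun L g x) <=
    ereal_sup (range (fun n => mine (distr_fun L (f_ n) l) (distr_fun L g x))).
  by apply: ereal_sup_ubound; exists n.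
by apply/negP; rewrite -ltNge lt_min vn vg.
Qed.

(** Cutting [f] off beyond n reduces to the bounded case, and the distribution functions of the cuts
    increase to that of [f]. The functions h produced there are only dominated by [g] in
    distribution, which is why the sets considered below are closed under domination. *)
Lemma resonance f g (B : \bar R) : mfuns L f -> mfuns L g ->
  (forall h, mfuns L h -> (forall x, 0 <= h x) ->
    (forall l, (0 < l)%R -> distr_fun L h l <= distr_fun L g l) ->
    \int[leb]_(x in D) (`|f x| * `|h x|) <= B) ->
  rearr_pairing L f g <= B.
Proof.
move=> mf mg HB.
pose I n : set LT := [set x | (x < n%:R)%R].
have mI n : measurable (I n).
  apply: (@measurable_interval R (I n)) => x y Ix Iy z /andP[_ zy].
  exact: le_lt_trans zy Iy.
pose f_ n x := f x * (\1_(I n) x : R)%:E.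
have mf_ n : mfuns L (f_ n).
  by apply: emeasurable_funM => //; exact: measurable_eindic.
have f_E n x : f_ n x = if (x < n%:R)%R then f x else 0.
  by rewrite /f_ indicE /I; case: ifPn => xn; [rewrite mem_set// mule1|rewrite memNset ?mule0//; exact/negP].
have sub_ l (m n : nat) : (0 < l)%R -> (m <= n)%N ->
    superlevel L (f_ m) l `<=` superlevel L (f_ n) l.
  move=> l0 mn x [Dx /=]; rewrite f_E; case: ifPn => [xm|_]; last first.
    by rewrite abse0 lte_fin ltNge (ltW l0).
  by move=> lf; split => //=; rewrite f_E (lt_le_trans xm) ?ler_nat.
apply: le_trans (rearr_pairing_le_sup mf mg mf_ _ _) _.
- move=> l l0 m n mn; apply: le_measure; rewrite ?inE; try exact: measurable_superlevel.
  exact: sub_.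
- move=> l l0; rewrite -superlevelE.
  have -> : superlevel L f l = \bigcup_n superlevel L (f_ n) l.
    apply/seteqP; split=> [x [Dx lf]|x [n _ [Dx /=]]]; last first.
      rewrite f_E; case: ifPn => // _.
      by rewrite abse0 lte_fin ltNge (ltW l0).
    have [n xn] : exists n : nat, (x < n%:R)%R.
      exists (Num.truncn (`|x : R|)%R).+1; apply: (le_lt_trans (ler_norm _)).
      exact: truncnS_gt.
    by exists n => //; split => //=; rewrite f_E xn.
  rewrite measure_bigcup_nondecreasing//; first by move=> n; exact: measurable_superlevel.
  by move=> m n mn; exact: sub_.
apply: ge_ereal_sup => _ [n _ <-].
have [||h [mh h0 hg]] := @resonance_bounded n%:R (f_ n) g _ (mf_ n) mg.
- by [].
- by move=> x Dx nx; rewrite f_E ltNge nx.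
move=> /le_trans; apply; apply: le_trans (HB h mh h0 hg).
apply: ge0_le_integral.
- exact: measurable_oitv.
- by move=> x _; rewrite mule_ge0.
- by apply: emeasurable_funM; exact: mfuns_abs.
- by apply: emeasurable_funM; exact: mfuns_abs.
- move=> x _; rewrite lee_wpmul2r// f_E; case: ifP => // _.
  by rewrite abse0.
Qed.

End rearrangement_resonance.

(** * Polar norms *)

Lemma ae_integral_le_sup d (T : measurableType d) (R : realType)
    (mu : {measure set T -> \bar R}) (D : set T) (F : T -> \bar R)
    (F_ : nat -> T -> \bar R) : measurable D ->
  measurable_fun D F -> (forall x, D x -> 0 <= F x) ->
  (forall k, measurable_fun D (F_ k)) -> (forall k x, D x -> 0 <= F_ k x) ->
  (\forall x \ae mu, D x -> {homo F_ ^~ x : m n / (m <= n)%N >-> m <= n} /\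
     F x <= ereal_sup (range (F_ ^~ x))) ->
  \int[mu]_(x in D) F x <= ereal_sup (range (fun k => \int[mu]_(x in D) F_ k x)).
Proof.
move=> mD mF F0 mF_ F_0 [N [mN N0 subN]].
have mDN : measurable (D `\` N) by exact: measurableD.
have DN x : (D `\` N) x -> D x /\ ({homo F_ ^~ x : m n / (m <= n)%N >-> m <= n} /\
     F x <= ereal_sup (range (F_ ^~ x))).
  move=> [Dx Nx]; split => //; apply: contrapT => H; apply: Nx; apply: subN => /= H'.
  by apply: H; exact: H'.
rewrite (ge0_negligible_integral _ _ _ _ N0)//.
have -> : (fun k => \int[mu]_(x in D) F_ k x) =
    (fun k => \int[mu]_(x in D `\` N) F_ k x).
  by apply/funext => k; apply: ge0_negligible_integral => // x; exact: F_0.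
apply: integral_le_sup => //.
- by apply: measurable_funS mF => // x [].
- by move=> x [/F0].
- by move=> k; apply: measurable_funS (mF_ k) => // x [].
- by move=> k x [Dx _]; exact: F_0.
- by move=> x /DN[_ []].
- by move=> x /DN[_ []].
Qed.

(* The library's hint fails to see the measure structure on the bare function. *)
#[local] Instance leb_ae_filter (R : realType) :
  Filter (nbhs (almost_everywhere (@completed_lebesgue_measure R))).
Proof. exact: (ae_filter_ringOfSetsType (@completed_lebesgue_measure R)). Qed.

Section mfuns_ge0_theory.
Context (R : realType) (L : \bar R).
Notation LT := (lebesgueType R).
Implicit Types (f g h : LT -> \bar R).
Notation D := (oitv 0 L : set LT).

Lemma mfuns_ge0_of f : mfuns L f -> (forall x, D x -> 0 <= f x) -> mfuns_ge0 L f.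
Proof. by move=> mf f0; split => //; apply: nearW. Qed.

Lemma mfuns_ge0_abs_ae f : mfuns_ge0 L f ->
  \forall t \ae @leb R, D t -> `|f t| = f t.
Proof. by move=> [_ f0]; apply: filterS f0 => t f0 Dt; rewrite gee0_abs// f0. Qed.

Lemma mfuns_ge0_abs f : mfuns L f -> mfuns_ge0 L (fun x => `|f x|).
Proof. by move=> mf; apply: mfuns_ge0_of => //; exact: mfuns_abs. Qed.

Lemma mfuns_ge0_scale (c : R) f : (0 <= c)%R -> mfuns_ge0 L f ->
  mfuns_ge0 L (fun x => c%:E * f x).
Proof.
move=> c0 [mf f0]; split; first exact: measurable_funeM.
by apply: filterS f0 => t f0 Dt; rewrite mule_ge0// f0.
Qed.

Lemma mfuns_ge0_indic (E : set LT) : measurable E ->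
  mfuns_ge0 L (fun x => (\1_E x : R)%:E).
Proof.
move=> mE; apply: mfuns_ge0_of => [|x _]; last by rewrite lee_fin.
exact: measurable_eindic.
Qed.

Lemma measurable_mulabs f h : mfuns L f -> mfuns L h ->
  measurable_fun D (fun x => `|f x| * `|h x|).
Proof. by move=> mf mh; apply: emeasurable_funM; exact: mfuns_abs. Qed.

(** Members of [mfuns_ge0] are nonnegative only almost everywhere; absolute values restore
    nonnegativity at every point, as monotonicity and additivity of the integral require. *)
Lemma integral_mulabs f h : mfuns_ge0 L f -> mfuns_ge0 L h ->
  \int[leb]_(x in D) (f x * h x) = \int[leb]_(x in D) (`|f x| * `|h x|).
Proof.
move=> f0 h0; apply: ae_eq_integral.
- exact: measurable_oitv.
- by apply: emeasurable_funM; [case: f0|case: h0].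
- by apply: measurable_mulabs; [case: f0|case: h0].
apply: filterS2 (mfuns_ge0_abs_ae f0) (mfuns_ge0_abs_ae h0) => t Hf Hh Dt.
by rewrite Hf// Hh.
Qed.

Lemma integral_mul_ge0 f h : mfuns_ge0 L f -> mfuns_ge0 L h ->
  0 <= \int[leb]_(x in D) (f x * h x).
Proof.
by move=> f0 h0; rewrite integral_mulabs//; apply: integral_ge0 => x _; rewrite mule_ge0.
Qed.

Lemma integral_mul_ae_le f g h : mfuns_ge0 L f -> mfuns_ge0 L g -> mfuns_ge0 L h ->
  (\forall t \ae @leb R, D t -> f t <= g t) ->
  \int[leb]_(x in D) (f x * h x) <= \int[leb]_(x in D) (g x * h x).
Proof.
move=> f0 g0 h0 fg; rewrite (integral_mulabs f0 h0) (integral_mulabs g0 h0).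
apply: ae_ge0_le_integral.
- exact: measurable_oitv.
- by move=> x _; rewrite mule_ge0.
- by apply: measurable_mulabs; [case: f0|case: h0].
- by move=> x _; rewrite mule_ge0.
- by apply: measurable_mulabs; [case: g0|case: h0].
apply: filterS3 (mfuns_ge0_abs_ae f0) (mfuns_ge0_abs_ae g0) fg => t Hf Hg fg Dt.
by apply: lee_wpmul2r => //; rewrite Hf// Hg// fg.
Qed.

Lemma integral_mulZ (c : R) f h : (0 <= c)%R -> mfuns_ge0 L f -> mfuns_ge0 L h ->
  \int[leb]_(x in D) (c%:E * f x * h x) = c%:E * \int[leb]_(x in D) (f x * h x).
Proof.
move=> c0 f0 h0; rewrite (integral_mulabs (mfuns_ge0_scale c0 f0) h0) (integral_mulabs f0 h0).
transitivity (\int[leb]_(x in D) (c%:E * (`|f x| * `|h x|))).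
  by apply: eq_integral => x _; rewrite abseM gee0_abs ?lee_fin// muleA.
apply: ge0_integralZl_EFin c0.
- exact: measurable_oitv.
- by move=> x _; rewrite mule_ge0.
- by apply: measurable_mulabs; [case: f0|case: h0].
Qed.

Lemma integral_mulC f h :
  \int[leb]_(x in D) (f x * h x) = \int[leb]_(x in D) (h x * f x).
Proof. by apply: eq_integral => x _; rewrite muleC. Qed.

Lemma integral_mulD f g h : mfuns_ge0 L f -> mfuns_ge0 L g -> mfuns_ge0 L h ->
  \int[leb]_(x in D) ((f x + g x) * h x) =
  \int[leb]_(x in D) (f x * h x) + \int[leb]_(x in D) (g x * h x).
Proof.
move=> f0 g0 h0; rewrite (integral_mulabs f0 h0) (integral_mulabs g0 h0).
have mfh : measurable_fun D (fun x => `|f x| * `|h x|).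
  by apply: measurable_mulabs; [case: f0|case: h0].
have mgh : measurable_fun D (fun x => `|g x| * `|h x|).
  by apply: measurable_mulabs; [case: g0|case: h0].
rewrite -(ge0_integralD leb (measurable_oitv 0 L) _ mfh _ mgh);
  [|by move=> x _; rewrite mule_ge0..].
apply: ae_eq_integral.
- exact: measurable_oitv.
- apply: emeasurable_funM; last by case: h0.
  by apply: emeasurable_funD; [case: f0|case: g0].
- exact: emeasurable_funD.
- apply: filterS3 (mfuns_ge0_abs_ae f0) (mfuns_ge0_abs_ae g0)
    (mfuns_ge0_abs_ae h0) => t Hf Hg Hh Dt.
  by rewrite -Hf// -Hg// -Hh// !abse_id ge0_muleDl.
Qed.

Lemma integral_mul_indic (E : set LT) f : measurable E -> E `<=` D ->
  \int[leb]_(x in D) (f x * (\1_E x : R)%:E) = \int[leb]_(x in E) f x.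
Proof.
move=> mE ED; rewrite -{2}(setIidr ED) integral_mkcondr.
apply: eq_integral => x _; rewrite patchE indicE.
by have [xE|xE] := boolP (x \in E); rewrite ?mule1 ?mule0.
Qed.

Lemma mfuns_ge0_rearr f : mfuns_ge0 L (rearr L f).
Proof. by apply: mfuns_ge0_of => [|x _]; [exact: mfuns_rearr|exact: rearr_ge0]. Qed.

End mfuns_ge0_theory.

(** For c = +oo the convention 0 * oo = 0 separates a vanishing supremum from a positive one; in the
    latter case a single positive term already gives +oo. *)
Lemma ereal_supMr_le (R : realType) (u : nat -> \bar R) (c : \bar R) :
  (forall k, 0 <= u k) -> 0 <= c ->
  ereal_sup (range u) * c <= ereal_sup (range (fun k => u k * c)).
Proof.
move=> u0; case: c => [r| |]//.
  rewrite lee_fin => r0; rewrite muleC -ereal_supZl//; last first.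
    by apply/set0P; exists (u 0%N); exists 0%N.
  rewrite image_comp; apply: ge_ereal_sup => _ [n _ <-] /=.
  by rewrite muleC; apply: ereal_sup_ubound; exists n.
move=> _; have [su|su] := leP (ereal_sup (range u)) 0.
  have -> : ereal_sup (range u) = 0.
    apply/eqP; rewrite eq_le su; apply: (le_trans (u0 0%N)).
    by apply: ereal_sup_ubound; exists 0%N.
  rewrite mul0e; apply: (@le_trans _ _ (u 0%N * +oo)); first by rewrite mule_ge0.
  by apply: ereal_sup_ubound; exists 0%N.
have /ereal_sup_gt[_ [n _ <-] un] := su.
by rewrite gt0_muley// -[leLHS](gt0_muley un); apply: ereal_sup_ubound; exists n.
Qed.

Section polar_norm.
Context (R : realType) (L : \bar R) (L0 : 0 < L).
Notation LT := (lebesgueType R).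
Implicit Types (f g h : LT -> \bar R) (S : set (LT -> \bar R)).
Notation D := (oitv 0 L : set LT).

(** [assoc_norm L N] is convertible to [polar L (unit_ball L N)], so everything about polars applies
    to associate norms. *)
Definition polar S f : \bar R :=
  ereal_sup [set \int[leb]_(t in D) (f t * g t) | g in S].

Lemma polar_ub S f h : S h -> \int[leb]_(t in D) (f t * h t) <= polar S f.
Proof. by move=> Sh; apply: ereal_sup_ubound; exists h. Qed.

Lemma polar_le S f (B : \bar R) :
  (forall h, S h -> \int[leb]_(t in D) (f t * h t) <= B) -> polar S f <= B.
Proof. by move=> H; apply: ge_ereal_sup => _ [h Sh <-]; exact: H. Qed.

Lemma rearr_pairing_congl f f' g :
  (forall l, (0 < l)%R -> distr_fun L f l = distr_fun L f' l) ->
  rearr_pairing L f g = rearr_pairing L f' g.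
Proof.
move=> ff'; apply: eq_integral => l; rewrite inE => /andP[l0 _].
by apply: eq_integral => m _; rewrite ff'.
Qed.

(** Closure under domination of distribution functions contains both lattice solidity and
    rearrangement invariance. *)
Record rearr_solid S : Prop := {
  rs_mfuns : forall h, S h -> mfuns_ge0 L h ;
  rs_down : forall h h', S h -> mfuns_ge0 L h' ->
    (forall l, (0 < l)%R -> distr_fun L h' l <= distr_fun L h l) -> S h' }.

(** Together with [integral_mul_pairing] this makes the polar of a solid set a supremum of values of
    [rearr_pairing], which see f only through its distribution function; (P6) follows. *)
Lemma polar_pairing_ge S f h : rearr_solid S -> mfuns_ge0 L f -> S h ->
  rearr_pairing L f h <= polar S f.
Proof.
move=> [SM Sd] f0 Sh; have h0 := SM _ Sh.
apply: resonance; [by case: f0|by case: h0|] => h' mh' h'0 h'h.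
have h'M : mfuns_ge0 L h' by apply: mfuns_ge0_of.
rewrite -(integral_mulabs f0 h'M); apply: polar_ub.
exact: Sd h'h.
Qed.

Lemma integral_mul_pairing f h : mfuns_ge0 L f -> mfuns_ge0 L h ->
  \int[leb]_(t in D) (f t * h t) <= rearr_pairing L f h.
Proof.
move=> f0 h0; rewrite (integral_mulabs f0 h0).
by apply: hardy_littlewood; [case: f0|case: h0].
Qed.

Section polar_ri.
Context (S : set (LT -> \bar R)) (solidS : rearr_solid S).
Context (S_fin : forall E : set LT, measurable E -> E `<=` D -> leb E < +oo ->
  polar S (fun t => (\1_E t)%:E) < +oo).
Context (S_pos : forall E : set LT, measurable E -> E `<=` D -> leb E < +oo ->
  leb E < L -> exists2 c : R, (0 < c)%R & S (fun t => c%:E * (\1_E t)%:E)).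

Let SM := rs_mfuns solidS.

Let S_nonempty : exists h, S h.
Proof.
have [||||c _ Sc] := @S_pos set0; rewrite ?measure0//.
by exists (fun t => c%:E * (\1_set0 t)%:E).
Qed.

Lemma polar_ge0 f : mfuns_ge0 L f -> 0 <= polar S f.
Proof.
move=> f0; have [h Sh] := S_nonempty; apply: le_trans (polar_ub f Sh).
by apply: integral_mul_ge0 => //; exact: SM.
Qed.

Lemma polar_ae_le f g : mfuns_ge0 L f -> mfuns_ge0 L g ->
  (\forall t \ae @leb R, D t -> f t <= g t) -> polar S f <= polar S g.
Proof.
move=> f0 g0 fg; apply: polar_le => h Sh; apply: le_trans (polar_ub g Sh).
by apply: integral_mul_ae_le => //; exact: SM.
Qed.

Lemma polar_local_small (E : set LT) : measurable E -> E `<=` D ->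
  leb E < +oo -> leb E < L -> exists2 C : R, (0 < C)%R &
  forall f, mfuns_ge0 L f -> \int[leb]_(t in E) f t <= C%:E * polar S f.
Proof.
move=> mE ED Eoo EL; have [c c0 Sc] := S_pos mE ED Eoo EL.
exists c^-1%R; rewrite ?invr_gt0// => f f0; have := polar_ub f Sc.
have E0 := @mfuns_ge0_indic R L E mE.
rewrite integral_mulC (integral_mulZ (ltW c0) E0 f0) integral_mulC integral_mul_indic//.
by move=> H; rewrite lee_pdivlMl.
Qed.

(** [S_pos] excludes sets of full measure, because an image H g may tend to 0 at a finite endpoint
    L. Such a set is cut at L / 2 into two pieces of measure at most L / 2. *)
Lemma polar_local (E : set LT) : measurable E -> E `<=` D ->
  leb E < +oo -> exists2 C : R, (0 < C)%R &
  forall f, mfuns_ge0 L f -> \int[leb]_(t in E) f t <= C%:E * polar S f.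
Proof.
move=> mE ED Eoo.
have [EL|LE] := ltP (leb E) L; first exact: polar_local_small.
have [r Lr] : exists r : R, L = r%:E.
  have : L < +oo by exact: le_lt_trans Eoo.
  by case: L L0 => [r| |]// _ _; exists r.
have r0 : (0 < r)%R by move: L0; rewrite Lr lte_fin.
pose I : set LT := `]0%R, (r / 2)%R]%classic.
have mI : measurable I by apply: measurable_interval; exact: interval_is_interval.
have mI' : measurable (`](r / 2)%R, r[%classic : set LT).
  by apply: measurable_interval; exact: interval_is_interval.
have mE1 : measurable (E `&` I) by exact: measurableI.
have mE2 : measurable (E `\` I) by exact: measurableD.
have small1 : leb (E `&` I) <= (r / 2)%:E.
  apply: (@le_trans _ _ (leb I)); first by apply: le_measure; rewrite ?inE.
  by rewrite leb_itv/= lte_fin divr_gt0//= oppr0 adde0.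
have small2 : leb (E `\` I) <= (r / 2)%:E.
  apply: (@le_trans _ _ (leb (`](r / 2)%R, r[%classic : set LT))).
    apply: le_measure; rewrite ?inE// => x [Ex Ix].
    have := ED _ Ex; rewrite Lr => /andP[]; rewrite !lte_fin => x0 xr.
    rewrite /= in_itv/= xr andbT ltNge; apply/negP => xr2; apply: Ix.
    by rewrite /I/= in_itv/= x0.
  rewrite leb_itv/= lte_fin ifT; last by lra.
  by rewrite -EFinB lee_fin; lra.
have r2L : (r / 2)%:E < L by rewrite Lr lte_fin; lra.
have [||||C1 C10 HC1] := @polar_local_small (E `&` I) => //.
- by move=> x [/ED].
- by rewrite (le_lt_trans small1)// ltry.
- exact: le_lt_trans r2L.
have [||||C2 C20 HC2] := @polar_local_small (E `\` I) => //.
- by move=> x [/ED].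
- by rewrite (le_lt_trans small2)// ltry.
- exact: le_lt_trans r2L.
exists (C1 + C2)%R; first by rewrite addr_gt0.
move=> f f0; have [mf _] := f0.
have EU : \int[leb]_(t in E) f t =
    \int[leb]_(t in E `&` I) f t + \int[leb]_(t in E `\` I) f t.
  have ae_abs A : measurable A -> A `<=` D ->
      \int[leb]_(t in A) f t = \int[leb]_(t in A) `|f t|.
    move=> mA AD; apply: ae_eq_integral mA _ _ _.
    - by apply: measurable_funS mf => //; exact: measurable_oitv.
    - by apply: measurable_funS (mfuns_abs mf) => //; exact: measurable_oitv.
    - by apply: filterS (mfuns_ge0_abs_ae f0) => t H At; rewrite H//; exact: AD.
  rewrite !ae_abs//; [|by move=> x [/ED]|by move=> x [/ED]].
  transitivity (\int[leb]_(t in (E `&` I) `|` (E `\` I)) `|f t|).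
    by rewrite setUIDK.
  apply: ge0_integral_setU mE1 mE2 _ _ _ _.
  - by rewrite setUIDK; apply: measurable_funS (mfuns_abs mf) => //; exact: measurable_oitv.
  - by move=> x _; exact: abse_ge0.
  - by rewrite disj_set2E; apply/eqP/seteqP; split => // x [[_ Ix] []].
rewrite EU EFinD ge0_muleDl ?lee_fin ?(ltW C10) ?(ltW C20)//.
by apply: leeD; [exact: HC1|exact: HC2].
Qed.

Lemma polar_ri_norm : ri_norm L (polar S).
Proof.
split.
- exact: polar_ge0.
- move=> f f0; have [mf _] := f0; split => [Pf0|f_0]; last first.
    have -> : polar S f = ereal_sup [set 0].
      congr ereal_sup; have [h Sh] := S_nonempty.
      have int0 k : S k -> \int[leb]_(t in D) (f t * k t) = 0.
        move=> Sk; rewrite -[RHS](integral0 leb D); apply: ae_eq_integral.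
        + exact: measurable_oitv.
        + by apply: emeasurable_funM => //; case: (SM Sk).
        + exact: measurable_cst.
        + by apply: filterS f_0 => t f_0 Dt; rewrite f_0// mul0e.
      apply/seteqP; split => [_ [k Sk <-]|_ ->]; first exact: int0.
      by exists h => //; exact: int0.
    by rewrite ereal_sup1.
  (* Definiteness follows from (P5) on bounded pieces, which exhaust (0, L). *)
  have loc (n : nat) : \forall t \ae @leb R, (D `&` oitv 0 n%:R%:E) t -> `|f t| = 0.
    have mE : measurable (D `&` oitv 0 n%:R%:E : set LT).
      by apply: measurableI; exact: measurable_oitv.
    have ED : D `&` oitv 0 n%:R%:E `<=` D by move=> x [].
    have [|C C0 HC] := polar_local mE ED.
      by apply: (@leb_bounded_lty _ n%:R) => // x [].
    have := HC _ (mfuns_ge0_abs mf).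
    have -> : polar S (fun x => `|f x|) = 0.
      apply/eqP; rewrite eq_le (polar_ge0 (mfuns_ge0_abs mf)) andbT -Pf0.
      apply: polar_ae_le => //; first exact: mfuns_ge0_abs.
      by apply: filterS (mfuns_ge0_abs_ae f0) => t H Dt; rewrite H.
    rewrite mule0 => le0.
    have mfE : measurable_fun (D `&` oitv 0 n%:R%:E : set LT) f.
      by apply: measurable_funS mf => //; exact: measurable_oitv.
    have int0 : \int[leb]_(x in D `&` oitv 0 n%:R%:E) `|f x| = 0.
      by apply/eqP; rewrite eq_le le0; apply: integral_ge0.
    have := (ae_eq_integral_abs leb mE mfE).1 int0.
    by apply: filterS => t H Dt; rewrite H// abse0.
  have := ae_foralln loc.
  apply: filterS => t H Dt; apply/eqP; rewrite -abse_eq0; apply/eqP.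
  apply: (H (Num.truncn (`|t : R|)%R).+1); split => //; have /andP[t0 _] := Dt.
  apply/andP; split => //; rewrite lte_fin; apply: (le_lt_trans (ler_norm _)).
  exact: truncnS_gt.
- move=> l f l0 f0; have [h Sh] := S_nonempty.
  rewrite /polar -ereal_supZl//; last first.
    by apply/set0P; exists (\int[leb]_(t in D) (f t * h t)); exists h.
  congr ereal_sup; rewrite image_comp; apply: eq_imagel => k Sk /=.
  by rewrite integral_mulZ//; exact: SM.
- move=> f g f0 g0; apply: polar_le => h Sh; rewrite (integral_mulD f0 g0 (SM Sh)).
  by apply: leeD; exact: polar_ub.
- exact: polar_ae_le.
- move=> f_ f fM_ fM fE.
  have nd m n : (m <= n)%N -> polar S (f_ m) <= polar S (f_ n).
    move=> mn; apply: polar_ae_le => //.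
    by apply: filterS fE => t fE Dt; have [ndf _] := fE Dt; exact: ndf.
  split => //.
  have fsup : \forall t \ae @leb R, D t -> f t = ereal_sup (range (f_ ^~ t)).
    apply: filterS fE => t fE Dt; have [ndf cf] := fE Dt.
    rewrite -(cvg_lim (@ereal_hausdorff _) cf); apply: (cvg_lim (@ereal_hausdorff _)).
    by apply: ereal_nondecreasing_cvgn => m n mn; exact: ndf.
  have -> : polar S f = ereal_sup (range (fun k => polar S (f_ k))).
    apply/eqP; rewrite eq_le; apply/andP; split; last first.
      apply: ge_ereal_sup => _ [n _ <-]; apply: polar_ae_le => //.
      by apply: filterS fsup => t H Dt; rewrite H//; apply: ereal_sup_ubound; exists n.
    (* For (P3), monotone convergence is applied for each fixed h; after that only two suprema are
       interchanged. *)
    apply: polar_le => h Sh; have hM := SM Sh.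
    apply: (@le_trans _ _ (ereal_sup (range (fun k => \int[leb]_(t in D) (f_ k t * h t))))).
      rewrite (integral_mulabs fM hM).
      have -> : (fun k => \int[leb]_(t in D) (f_ k t * h t)) =
          (fun k => \int[leb]_(t in D) (`|f_ k t| * `|h t|)).
        by apply/funext => k; exact: integral_mulabs.
      apply: ae_integral_le_sup.
      + exact: measurable_oitv.
      + by apply: measurable_mulabs; [case: fM|case: hM].
      + by move=> x _; rewrite mule_ge0.
      + by move=> k; apply: measurable_mulabs; [case: (fM_ k)|case: hM].
      + by move=> k x _; rewrite mule_ge0.
      have allabs := ae_foralln (fun k => mfuns_ge0_abs_ae (fM_ k)).
      apply: filterS3 (filterI fE fsup) (mfuns_ge0_abs_ae fM) allabs
        => t [fEt fst] ft fkt Dt.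
      have [ndf _] := fEt Dt.
      split; first by move=> m n mn; rewrite lee_wpmul2r// !fkt// ndf.
      rewrite ft// fst//.
      have -> : f_ ^~ t = (fun k => `|f_ k t|) by apply/funext => k; rewrite fkt.
      by apply: ereal_supMr_le.
    apply: ge_ereal_sup => _ [n _ <-]; apply: (le_trans (polar_ub (f_ n) Sh)).
    by apply: ereal_sup_ubound; exists n.
  exact: ereal_nondecreasing_cvgn.
- exact: S_fin.
- exact: polar_local.
- move=> f g f0 g0 fg.
  have le f' g' : mfuns_ge0 L f' -> mfuns_ge0 L g' -> equimeasurable L f' g' ->
      polar S f' <= polar S g'.
    move=> f'0 g'0 fg'; apply: polar_le => h Sh.
    apply: (le_trans (integral_mul_pairing f'0 (SM Sh))).
    by rewrite (rearr_pairing_congl _ fg') polar_pairing_ge.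
  apply/eqP; rewrite eq_le le//= le// => l l0.
  by rewrite fg.
Qed.

End polar_ri.
End polar_norm.

(** * Rearrangement-invariant norms, their unit balls and associate norms *)

Section ri_norm_theory.
Context (R : realType) (L : \bar R) (L0 : 0 < L).
Notation LT := (lebesgueType R).
Implicit Types (f g h : LT -> \bar R).
Notation D := (oitv 0 L : set LT).
Context (N : (LT -> \bar R) -> \bar R) (riN : ri_norm L N).

Definition unit_ball : set (LT -> \bar R) := [set g | mfuns_ge0 L g /\ N g <= 1].

Lemma ri_norm_ae_eq f g : mfuns_ge0 L f -> mfuns_ge0 L g ->
  (\forall t \ae @leb R, D t -> f t = g t) -> N f = N g.
Proof.
move=> f0 g0 fg; apply/eqP; rewrite eq_le; apply/andP; split; apply: (rin_le riN) => //.
  by apply: filterS fg => t H Dt; rewrite H.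
by apply: filterS fg => t H Dt; rewrite H.
Qed.

Lemma ri_norm_abs f : mfuns_ge0 L f -> N (fun t => `|f t|) = N f.
Proof.
move=> f0; have [mf _] := f0; apply: ri_norm_ae_eq => //; first exact: mfuns_ge0_abs.
exact: mfuns_ge0_abs_ae.
Qed.

Lemma ri_norm_rearr f : mfuns_ge0 L f -> N (rearr L f) = N f.
Proof.
move=> f0; have [mf _] := f0; apply: (rin_equi riN) => //; first exact: mfuns_ge0_rearr.
by move=> l l0; apply: distr_fun_rearr => //; exact: ltW.
Qed.

(** Domination of distribution functions turns into pointwise domination of the rearrangements, so
    (P6) and (P2) combine. *)
Lemma ri_norm_distr_le f g : mfuns_ge0 L f -> mfuns_ge0 L g ->
  (forall l, (0 < l)%R -> distr_fun L f l <= distr_fun L g l) -> N f <= N g.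
Proof.
move=> f0 g0 fg; rewrite -(ri_norm_rearr f0) -(ri_norm_rearr g0).
apply: (rin_le riN); [exact: mfuns_ge0_rearr..|].
apply: nearW => t _; apply: ereal_inf_le_tmp => _ [k [k0 kt] <-].
by exists k => //; split => //; apply: le_trans kt; exact: fg.
Qed.

Lemma unit_ball_solid : rearr_solid L unit_ball.
Proof.
split => [h []//|h h' [h0 Nh] h'0 hh']; split => //.
by apply: le_trans Nh; exact: ri_norm_distr_le.
Qed.

Lemma ri_norm_indic_scaled (E : set LT) : measurable E -> E `<=` D ->
  leb E < +oo -> exists2 c : R, (0 < c)%R &
    unit_ball (fun t => c%:E * (\1_E t)%:E).
Proof.
move=> mE ED Eoo; have E0 := @mfuns_ge0_indic R L E mE.
have Nlt := rin_indic_fin riN mE ED Eoo; have Nge := rin_ge0 riN E0.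
have Nfin : N (fun t => (\1_E t)%:E) \is a fin_num by rewrite ge0_fin_numE.
pose a := fine (N (fun t => (\1_E t)%:E)).
have a0 : (0 <= a)%R by rewrite fine_ge0.
have c0 : (0 < (a + 1)^-1)%R by rewrite invr_gt0; lra.
(* The norm a is 0 when E is null, hence a + 1. *)
exists (a + 1)^-1%R => //; split; first exact: (mfuns_ge0_scale (ltW c0) E0).
rewrite (rin_scale riN (ltW c0) E0) -(fineK Nfin) -EFinM lee_fin.
by rewrite mulrC ler_pdivrMr -/a; lra.
Qed.

Lemma assoc_norm_indic_lty (E : set LT) : measurable E -> E `<=` D ->
  leb E < +oo -> polar L unit_ball (fun t => (\1_E t)%:E) < +oo.
Proof.
move=> mE ED Eoo; have [C C0 HC] := rin_loc_int riN mE ED Eoo.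
apply: (@le_lt_trans _ _ C%:E); last by rewrite ltry.
apply: polar_le => h [h0 Nh]; rewrite integral_mulC integral_mul_indic//.
by apply: (le_trans (HC _ h0)); rewrite -[leRHS]mule1; apply: lee_wpmul2l => //; rewrite lee_fin ltW.
Qed.

(** For the unit ball, the two nondegeneracy hypotheses on polars are (P5) and (P4) of [N]: duality
    exchanges these axioms. *)
Lemma assoc_norm_ri_norm : ri_norm L (assoc_norm L N).
Proof.
apply: (polar_ri_norm L0 unit_ball_solid); first exact: assoc_norm_indic_lty.
by move=> E mE ED Eoo _; exact: ri_norm_indic_scaled.
Qed.

(** Stated with a positive real bound [C] for the associate norm to keep 0 * oo out of the product.
    The values 0 and oo of N f cannot be scaled to 1 and are treated apart. *)
Lemma holder_assoc f g (C : R) : (0 < C)%R -> mfuns_ge0 L f -> mfuns_ge0 L g ->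
  assoc_norm L N g <= C%:E -> \int[leb]_(t in D) (f t * g t) <= C%:E * N f.
Proof.
move=> C0 f0 g0 gC; have Nf0 := rin_ge0 riN f0.
have [Nf_oo|Nf_oo] := eqVneq (N f) +oo; first by rewrite Nf_oo gt0_muley ?lte_fin// leey.
have Nf_fin : N f \is a fin_num by rewrite ge0_fin_numE// ltey.
have [Nf_0|Nf_0] := eqVneq (N f) 0.
  rewrite Nf_0 mule0 (_ : \int[leb]_(t in D) _ = 0)//.
  rewrite -[RHS](integral0 leb D); apply: ae_eq_integral.
  - exact: measurable_oitv.
  - by apply: emeasurable_funM; [case: f0|case: g0].
  - exact: measurable_cst.
  - apply: filterS ((rin_eq0 riN f0).1 Nf_0) => t H Dt.
    by rewrite H// mul0e.
pose a := fine (N f).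
have a0 : (0 < a)%R by rewrite -lte_fin fineK// lt0e Nf_0.
have ai0 : (0 <= a^-1)%R by rewrite invr_ge0 ltW.
have ball : unit_ball (fun t => (a^-1)%:E * f t).
  split; first exact: mfuns_ge0_scale.
  by rewrite (rin_scale riN)// -(fineK Nf_fin) -EFinM mulVf// gt_eqF.
have := le_trans (polar_ub L g ball) gC.
rewrite integral_mulC (integral_mulZ ai0 f0 g0) -(fineK Nf_fin) -/a.
by rewrite muleC lee_pdivrMr.
Qed.

End ri_norm_theory.

Local Close Scope ereal_scope.

(** * The Lorentz-Luxemburg theorem *)

Section bounded_functions.
Context (R : realType) (L : \bar R).
Notation LT := (lebesgueType R).
Notation D := (oitv 0 L : set LT).
Context (E : set LT) (mE : measurable E) (ED : E `<=` D) (Eoo : (leb E < +oo)%E).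
Implicit Types (F G : LT -> R).

(** As |E| is finite, such functions have finite integrals, and quadratic identities between them
    can be computed in [R]. *)
Definition bounded_on F : Prop :=
  [/\ measurable_fun D F, forall x, 0 <= F x, exists c, forall x, F x <= c &
      forall x, ~ E x -> F x = 0].

Definition intR F : R := fine (\int[leb]_(x in D) (F x)%:E)%E.

Lemma bounded_onE F : bounded_on F -> ((intR F)%:E = \int[leb]_(x in D) (F x)%:E)%E.
Proof.
move=> [mF F0 [c Fc] FE]; rewrite fineK// ge0_fin_numE; last first.
  by apply: integral_ge0 => x _; rewrite lee_fin.
apply: (@le_lt_trans _ _ (\int[leb]_(x in D) (c%:E * (\1_E x : R)%:E))%E).
  apply: ge0_le_integral.
  - exact: measurable_oitv.
  - by move=> x _; rewrite lee_fin.
  - exact/measurable_EFinP.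
  - by apply: measurable_funeM; exact: measurable_eindic.
  - move=> x _; rewrite -EFinM lee_fin indicE.
    by have [xE|xE] := boolP (x \in E); rewrite ?mulr1// FE ?mulr0// => Ex; rewrite mem_set in xE.
have c0 : 0 <= c by apply: le_trans (F0 0) (Fc 0).
rewrite (@integral_mul_indic _ _ E (fun=> c%:E) mE ED).
rewrite integral_cst//; apply: lte_mul_pinfty => //.
Qed.

Lemma bounded_onD F G : bounded_on F -> bounded_on G -> bounded_on (fun x => F x + G x).
Proof.
move=> [mF F0 [c Fc] FE] [mG G0 [d Gd] GE]; split.
- exact: measurable_funD.
- by move=> x; rewrite addr_ge0.
- by exists (c + d) => x; rewrite lerD.
- by move=> x nE; rewrite FE// GE// addr0.
Qed.

Lemma bounded_onM F G : bounded_on F -> bounded_on G -> bounded_on (fun x => F x * G x).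
Proof.
move=> [mF F0 [c Fc] FE] [mG G0 [d Gd] GE]; split.
- exact: measurable_funM.
- by move=> x; rewrite mulr_ge0.
- by exists (c * d) => x; rewrite ler_pM.
- by move=> x nE; rewrite FE// mul0r.
Qed.

Lemma bounded_onZ (a : R) F : 0 <= a -> bounded_on F -> bounded_on (fun x => a * F x).
Proof.
move=> a0 [mF F0 [c Fc] FE]; split.
- by apply: measurable_funM.
- by move=> x; rewrite mulr_ge0.
- by exists (a * c) => x; rewrite ler_wpM2l.
- by move=> x nE; rewrite FE// mulr0.
Qed.

Lemma bounded_on_sqrB F G : bounded_on F -> bounded_on G ->
  bounded_on (fun x => (F x - G x) ^+ 2).
Proof.
move=> [mF F0 [c Fc] FE] [mG G0 [d Gd] GE]; split.
- by apply: measurable_funX; exact: measurable_funB.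
- by move=> x; rewrite sqr_ge0.
- exists ((c + d) ^+ 2) => x; have := F0 x; have := Fc x; have := G0 x; have := Gd x.
  by move: (F x) (G x) => a b bd b0 ac a0; nra.
- by move=> x nE; rewrite FE// GE// subrr expr0n.
Qed.

Lemma bounded_on_le F G : bounded_on G -> measurable_fun D F ->
  (forall x, 0 <= F x <= G x) -> bounded_on F.
Proof.
move=> [mG G0 [c Gc] GE] mF FG; split => //.
- by move=> x; have /andP[] := FG x.
- by exists c => x; have /andP[_ /le_trans] := FG x; apply.
- move=> x nE; have /andP[F0] := FG x; rewrite GE// => F0'.
  by apply/eqP; rewrite eq_le F0 F0'.
Qed.

Lemma intRD F G : bounded_on F -> bounded_on G ->
  intR (fun x => F x + G x) = intR F + intR G.
Proof.
move=> bF bG; apply: EFin_inj.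
rewrite EFinD (bounded_onE (bounded_onD bF bG)) (bounded_onE bF) (bounded_onE bG).
under eq_integral do rewrite EFinD.
have [mF F0 _ _] := bF; have [mG G0 _ _] := bG.
apply: (ge0_integralD leb (measurable_oitv 0 L)).
- by move=> x _; rewrite lee_fin.
- exact/measurable_EFinP.
- by move=> x _; rewrite lee_fin.
- exact/measurable_EFinP.
Qed.

Lemma intRZ (a : R) F : 0 <= a -> bounded_on F ->
  intR (fun x => a * F x) = a * intR F.
Proof.
move=> a0 bF; apply: EFin_inj.
rewrite EFinM (bounded_onE (bounded_onZ a0 bF)) (bounded_onE bF).
under eq_integral do rewrite EFinM.
have [mF F0 _ _] := bF.
apply: (ge0_integralZl_EFin leb (measurable_oitv 0 L)) a0.
- by move=> x _; rewrite lee_fin.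
- exact/measurable_EFinP.
Qed.

Lemma intR_ge0 F : bounded_on F -> 0 <= intR F.
Proof.
move=> bF; rewrite -lee_fin (bounded_onE bF); have [_ F0 _ _] := bF.
by apply: integral_ge0 => x _; rewrite lee_fin.
Qed.

Lemma intR_le F G : bounded_on F -> bounded_on G -> (forall x, F x <= G x) ->
  intR F <= intR G.
Proof.
move=> bF bG FG; rewrite -lee_fin (bounded_onE bF) (bounded_onE bG).
have [mF F0 _ _] := bF; have [mG G0 _ _] := bG.
apply: ge0_le_integral.
- exact: measurable_oitv.
- by move=> x _; rewrite lee_fin.
- exact/measurable_EFinP.
- exact/measurable_EFinP.
- by move=> x _; rewrite lee_fin.
Qed.

Lemma bounded_on_mfuns F : bounded_on F -> mfuns_ge0 L (EFin \o F).
Proof.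
move=> [mF F0 _ _]; apply: mfuns_ge0_of; first exact/measurable_EFinP.
by move=> x _; rewrite lee_fin.
Qed.

Lemma bounded_on_indic : bounded_on (\1_E).
Proof.
split.
- exact: measurable_indic.
- by move=> x; rewrite indicE.
- by exists 1 => x; rewrite indicE; case: (_ \in _).
- by move=> x nE; rewrite indicE memNset.
Qed.

End bounded_functions.

(** * Projection in L^2 onto the part of the unit ball below f *)

Section projection.
Context (R : realType) (L : \bar R).
Notation LT := (lebesgueType R).
Notation D := (oitv 0 L : set LT).
Context (N : (LT -> \bar R) -> \bar R) (riN : ri_norm L N).
Context (E : set LT) (mE : measurable E) (ED : E `<=` D) (Eoo : (leb E < +oo)%E).
Implicit Types (F G f g h : LT -> R).

Notation bdd := (bounded_on L E).
Notation I := (intR L).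
Notation Nr F := (N (fun x => (F x)%:E)).

Let bddM F : bdd F -> mfuns_ge0 L (fun x => (F x)%:E).
Proof. exact: bounded_on_mfuns. Qed.

Lemma ri_norm_le_bounded F G : bdd F -> bdd G -> (forall x, F x <= G x) ->
  (Nr F <= Nr G)%E.
Proof.
move=> bF bG FG; apply: (rin_le riN) (bddM bF) (bddM bG) _.
by apply: nearW => x _; rewrite lee_fin.
Qed.

Lemma ri_norm_convex (s : R) F G : 0 <= s <= 1 -> bdd F -> bdd G ->
  (Nr F <= 1)%E -> (Nr G <= 1)%E ->
  (Nr (fun x => (1 - s) * F x + s * G x) <= 1)%E.
Proof.
move=> /andP[s0 s1] bF bG NF NG; have s1' : 0 <= 1 - s by rewrite subr_ge0.
apply: le_trans (rin_triangle riN (mfuns_ge0_scale s1' (bddM bF))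
  (mfuns_ge0_scale s0 (bddM bG))) _.
rewrite (rin_scale riN s1' (bddM bF)) (rin_scale riN s0 (bddM bG)).
apply: (@le_trans _ _ ((1 - s)%:E * 1 + s%:E * 1)%E).
  by apply: leeD; apply: lee_wpmul2l; rewrite ?lee_fin.
by rewrite !mule1 -EFinD lee_fin; lra.
Qed.

(* The parallelogram law makes a minimizing sequence of the squared distance to
   [f] summably Cauchy in L1, so its lower limit attains the infimum; only the
   Fatou property of [N] is used to keep the limit in the unit ball. *)
Lemma projection_exists f : bdd f -> exists h, [/\ bdd h, forall x, h x <= f x,
  (Nr h <= 1)%E & forall h', bdd h' -> (forall x, h' x <= f x) -> (Nr h' <= 1)%E ->
    I (fun x => (f x - h x) ^+ 2) <= I (fun x => (f x - h' x) ^+ 2)].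
Proof.
move=> bf; have [mf f0 [M fM] fE] := bf.
have M0 : 0 <= M by apply: le_trans (f0 0) (fM 0).
pose q h := I (fun x => (f x - h x) ^+ 2).
pose B h := [/\ bdd h, forall x, h x <= f x & (Nr h <= 1)%E].
have bq h : bdd h -> bdd (fun x => (f x - h x) ^+ 2) by move=> bh; exact: bounded_on_sqrB.
pose Q : set R := [set q h | h in B].
have Q_lb : lbound Q 0 by move=> _ [h [bh _ _] <-]; apply: (intR_ge0 mE ED Eoo); exact: bq.
have b0 : bdd (fun=> 0).
  by apply: (bounded_on_le bf) => [|x]; [exact: measurable_cst|rewrite lexx f0].
have N0 : Nr (fun=> 0) = 0%E.
  by apply: (rin_eq0 riN (bddM b0)).2; apply: nearW => x _.
have B0 : B (fun=> 0) by split => //; rewrite N0 lee_fin.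
have Q_inf : has_inf Q by split; [exists (q (fun=> 0)); exists (fun=> 0)|exists 0].
pose d := inf Q.
(* The infimum is approached up to e n squared, so that consecutive terms are at L^2 distance of
   order e n, which is summable. *)
pose e (n : nat) : R := (2^-1) ^+ n.
have e_gt0 n : 0 < e n by rewrite exprn_gt0.
have eS n : e n.+1 = e n / 2 by rewrite /e exprSr.
have d_le h : B h -> d <= q h by move=> Bh; apply: ge_inf; [exists 0|exists h].
have /choice[h_ Bh_] : forall n, exists h, B h /\ q h < d + (e n) ^+ 2.
  move=> n; have [_ [h Bh <-] qh] := inf_adherent (exprn_gt0 2 (e_gt0 n)) Q_inf.
  by exists h.
have bh n : bdd (h_ n) by have [[]] := Bh_ n.
have hf n x : h_ n x <= f x by have [[_ + _] _] := Bh_ n; apply.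
have Nh n : (Nr (h_ n) <= 1)%E by have [[]] := Bh_ n.
have qh n : q (h_ n) < d + (e n) ^+ 2 by have [] := Bh_ n.
have h0 n x : 0 <= h_ n x by have [_ + _ _] := bh n; apply.
(* Parallelogram law with the midpoint m, which is again a competitor and hence at squared distance
   at least d. *)
have sq_step n : I (fun x => (h_ n x - h_ n.+1 x) ^+ 2) <= 4 * (e n) ^+ 2.
  pose m x := (1 - 2^-1) * h_ n x + 2^-1 * h_ n.+1 x.
  have bm : bdd m by apply: bounded_onD; apply: bounded_onZ => //; lra.
  have Bm : B m.
    split => //; last by apply: ri_norm_convex => //; apply/andP; split; lra.
    by move=> x; rewrite /m; have := hf n x; have := hf n.+1 x; lra.
  have b1 := bounded_on_sqrB (bh n) (bh n.+1).
  have := @intRD _ _ _ mE ED Eoo _ _ b1 (bounded_onZ (ler0n _ 4) (bq _ bm)).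
  have -> : (fun x => (h_ n x - h_ n.+1 x) ^+ 2 + 4 * (f x - m x) ^+ 2) =
      (fun x => 2 * (f x - h_ n x) ^+ 2 + 2 * (f x - h_ n.+1 x) ^+ 2).
    by apply/funext => x; rewrite /m; field.
  rewrite (intRD mE ED Eoo (bounded_onZ (ler0n _ 2) (bq _ (bh n)))
    (bounded_onZ (ler0n _ 2) (bq _ (bh n.+1)))).
  rewrite (intRZ mE ED Eoo (ler0n _ 2) (bq _ (bh n))).
  rewrite (intRZ mE ED Eoo (ler0n _ 2) (bq _ (bh n.+1))).
  rewrite (intRZ mE ED Eoo (ler0n _ 4) (bq _ bm)).
  rewrite -/(q (h_ n)) -/(q (h_ n.+1)) -/(q m) => H.
  have := d_le _ Bm; have := qh n; have := qh n.+1; rewrite eS.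
  have : (e n / 2) ^+ 2 <= (e n) ^+ 2.
    by rewrite ler_pXn2r ?nnegrE ?divr_ge0 ?ltW//; have := e_gt0 n; lra.
  by move: H; lra.
pose cE := I (\1_E).
have b1E := @bounded_on_indic R L E mE.
have cE0 : 0 <= cE by exact: (intR_ge0 mE ED Eoo).
pose a n x := `|h_ n x - h_ n.+1 x|.
have ba n : bdd (a n).
  apply: (bounded_on_le (bounded_onD (bh n) (bh n.+1))).
    have [m1 _ _ _] := bh n; have [m2 _ _ _] := bh n.+1.
    exact: (measurableT_comp (@normr_measurable R setT) (measurable_funB m1 m2)).
  move=> x; rewrite normr_ge0/= /a; have := h0 n x; have := h0 n.+1 x.
  by move=> ? ?; rewrite ler_norml; apply/andP; split; lra.
pose C := cE + 4.
have C0 : 0 <= C by rewrite addr_ge0.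
(* In place of Cauchy-Schwarz: t <= e + t^2 / e on E. Integrating gives |E| e + 4 e, whence C = |E|
   + 4. *)
have a_step n : I (a n) <= C * e n.
  have b1 := bounded_on_sqrB (bh n) (bh n.+1).
  have ei0 : 0 <= (e n)^-1 by rewrite invr_ge0 ltW.
  have bE := bounded_onZ (ltW (e_gt0 n)) b1E; have bS := bounded_onZ ei0 b1.
  apply: le_trans (intR_le mE ED Eoo (ba n) (bounded_onD bE bS) _) _.
    move=> x; have [Ex|nEx] := pselect (E x); last first.
      have [_ _ _ a0] := ba n; have [_ bE0 _ _] := bE; have [_ bS0 _ _] := bS.
      by rewrite a0// addr_ge0 ?bE0 ?bS0.
    rewrite /= indicE mem_set// mulr1 /a -[X in _ + _ * X]real_normK ?num_real//.
    move: `|_| (normr_ge0 (h_ n x - h_ n.+1 x)) => t t0.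
    rewrite -(ler_pM2l (e_gt0 n)) mulrDr mulrA divff ?gt_eqF// mul1r.
    by have := e_gt0 n; nra.
  rewrite (intRD mE ED Eoo bE bS) (intRZ mE ED Eoo (ltW (e_gt0 n)) b1E) (intRZ mE ED Eoo ei0 b1).
  have : (e n)^-1 * I (fun x => (h_ n x - h_ n.+1 x) ^+ 2) <= 4 * e n.
    by rewrite mulrC ler_pdivrMr//; have := sq_step n; rewrite expr2 mulrA.
  by rewrite -/cE /C; lra.
pose S n j x := \sum_(i < j) a (n + i)%N x.
have bS n j : bdd (S n j).
  elim: j => [|j IH]; first by rewrite (_ : S n 0 = fun=> 0)//; apply/funext => x; rewrite /S big_ord0.
  rewrite (_ : S n j.+1 = fun x => S n j x + a (n + j)%N x).
    exact: bounded_onD.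
  by apply/funext => x; rewrite /S big_ord_recr.
(* Since e n = 2 (e n - e n.+1), the bound telescopes. *)
have S_int n j : I (S n j) <= 2 * C * (e n - e (n + j)%N).
  elim: j => [|j IH].
    rewrite addn0 subrr mulr0 (_ : S n 0 = fun=> 0 * 0 : R).
      by rewrite (intRZ mE ED Eoo (lexx 0) b0) mul0r.
    by apply/funext => x; rewrite /S big_ord0 mul0r.
  rewrite (_ : S n j.+1 = fun x => S n j x + a (n + j)%N x); last first.
    by apply/funext => x; rewrite /S big_ord_recr.
  rewrite (intRD mE ED Eoo (bS n j) (ba _)) addnS eS.
  by have := a_step (n + j)%N; move: IH; set u := e (n + j)%N; lra.
have hS n j x : h_ n x - S n j x <= h_ (n + j)%N x.
  elim: j => [|j IH]; first by rewrite addn0 /S big_ord0 subr0.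
  rewrite /S big_ord_recr/= -/(S n j x) addnS.
  have := ler_norm (h_ (n + j)%N x - h_ (n + j).+1 x); rewrite -/(a (n + j)%N x).
  by move: IH; lra.
(* The lower limit is H = sup K n. It exists at every point, and the increasing sequence K n <= h_ n
   is of the form to which (P3) applies. *)
pose K n x := infs (h_ ^~ x) n.
have lb_h x : has_lbound (range (h_ ^~ x)) by exists 0 => _ [n _ <-].
have lb_hd n x : has_lbound (sdrop (h_ ^~ x) n) by exists 0 => _ [m _ <-].
have K_le n m x : (n <= m)%N -> K n x <= h_ m x.
  by move=> nm; apply: ge_inf => //; exists m.
have K_ge n x c : (forall m, (n <= m)%N -> c <= h_ m x) -> c <= K n x.
  by move=> H; apply: lb_le_inf; [exists (h_ n x); exists n => /=|move=> _ [m nm <-]; exact: H].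
have K0 n x : 0 <= K n x by apply: K_ge.
have Kf n x : K n x <= f x by apply: le_trans (K_le n n x (leqnn n)) (hf n x).
have K_nd m n x : (m <= n)%N -> K m x <= K n x.
  by move=> mn; apply: K_ge => k nk; apply: K_le; exact: leq_trans nk.
have mK n : measurable_fun D (K n).
  by apply: measurable_fun_infs => // m; have [] := bh m.
have bK n : bdd (K n).
  by apply: (bounded_on_le bf) => // x; rewrite K0 Kf.
pose H x := sups (K ^~ x) 0%N.
have ub_K x : has_ubound (range (K ^~ x)) by exists (f x) => _ [n _ <-].
have H_ge n x : K n x <= H x.
  by apply: ub_le_sup; [exists (f x) => _ [m _ <-]|exists n].
have Hf x : H x <= f x.
  by apply: ge_sup; [exists (K 0%N x); exists 0%N|move=> _ [m _ <-]].
have mH : measurable_fun D H by apply: measurable_fun_sups.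
have bH : bdd H.
  by apply: (bounded_on_le bf) => // x; rewrite Hf (le_trans (K0 0%N x)).
have HK x : (H x)%:E = ereal_sup (range (fun n => (K n x)%:E)).
  rewrite /H /sups -ereal_sup_EFin; [|by exists (f x) => _ [m _ <-]|by exists (K 0%N x); exists 0%N].
  by congr ereal_sup; rewrite /sdrop image_comp; apply/seteqP; split => _ [n _ <-]; exists n.
have NH : (Nr H <= 1)%E.
  have [_ NKH] := @rin_fatou _ _ _ riN (fun n x => (K n x)%:E) (fun x => (H x)%:E)
    (fun n => bddM (bK n)) (bddM bH) (nearW _ (fun t _ => conj
       (fun m n mn => eq_ind_r is_true (K_nd m n t mn) (lee_fin _ _))
       (eq_ind_r (fun l => (K n t)%:E @[n --> \oo] --> l)
          (ereal_nondecreasing_cvgn (fun m n mn =>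
             eq_ind_r is_true (K_nd m n t mn) (lee_fin _ _))) (HK t)))).
  rewrite -(cvg_lim (@ereal_hausdorff _) NKH); apply: lime_le.
    by apply/cvg_ex; eexists; exact: NKH.
  apply: nearW => n; apply: le_trans (Nh n); apply: ri_norm_le_bounded => // x.
  exact: K_le.
have bhK n : bdd (fun x => h_ n x - K n x).
  apply: (bounded_on_le (bh n)).
    by apply: measurable_funB => //; have [] := bh n.
  move=> x; rewrite subr_ge0 K_le//= lerBlDr lerDl//.
(* By [hS], no later term falls below h_ n by more than the supremum of the sums S n j, so neither
   does their infimum K n. *)
have hK_int n : I (fun x => h_ n x - K n x) <= 2 * C * e n.
  rewrite -lee_fin (bounded_onE mE ED Eoo (bhK n)).
  apply: (@le_trans _ _ (ereal_sup (range (fun j => \int[leb]_(x in D) (S n j x)%:E)%E))).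
    have Snd j x : S n j x <= S n j.+1 x by rewrite /S big_ord_recr/= lerDl; exact: normr_ge0.
    apply: integral_le_sup.
    - exact: measurable_oitv.
    - by have [? _ _ _] := bhK n; exact/measurable_EFinP.
    - by move=> x _; rewrite lee_fin subr_ge0 K_le.
    - by move=> j; have [? _ _ _] := bS n j; exact/measurable_EFinP.
    - by move=> j x _; rewrite lee_fin; have [_ + _ _] := bS n j; apply.
    - move=> x _ i j ij; rewrite lee_fin -(subnKC ij).
      by elim: (j - i)%N => [|k IH]; rewrite ?addn0// addnS (le_trans IH).
    move=> x _; set s := ereal_sup _.
    have Ss j : ((S n j x)%:E <= s)%E by apply: ereal_sup_ubound; exists j.
    case: s Ss => [r| |] Ss; [|by rewrite leey|by have := Ss 0%N].
    rewrite lee_fin lerBlDr -lerBlDl; apply: K_ge => m nm.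
    apply: le_trans (_ : h_ n x - S n (m - n)%N x <= _); last by have := hS n (m - n)%N x; rewrite subnKC.
    by rewrite lerD2l lerN2 -lee_fin.
  apply: ge_ereal_sup => _ [j _ <-].
  rewrite -(bounded_onE mE ED Eoo (bS n j)) lee_fin; apply: le_trans (S_int n j) _.
  by rewrite ler_wpM2l ?mulr_ge0// lerBlDr lerDl ltW.
(* The squares differ by (h - K)(2 f - h - K), which is at most 2 M (h - K). *)
have qK n : q (K n) <= q (h_ n) + 2 * M * (2 * C * e n).
  have M2 : 0 <= 2 * M by rewrite mulr_ge0.
  have bMhK := bounded_onZ M2 (bhK n).
  apply: le_trans (intR_le mE ED Eoo (bq _ (bK n)) (bounded_onD (bq _ (bh n)) bMhK) _) _.
    move=> x; have := K0 n x; have := K_le n n x (leqnn n); have := hf n x; have := fM x.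
    by move: (f x) (h_ n x) (K n x) => F' h' k' *; nra.
  rewrite (intRD mE ED Eoo (bq _ (bh n)) bMhK) lerD2l (intRZ mE ED Eoo M2 (bhK n)).
  by rewrite ler_wpM2l.
have qH n : q H <= q (K n).
  apply: (intR_le mE ED Eoo); [exact: bq|exact: bq|] => x.
  by rewrite ler_pXn2r ?nnegrE ?subr_ge0// lerD2l lerN2.
have qHd : q H <= d.
  apply/ler_addgt0Pr => eps eps0.
  pose A := 1 + 2 * M * (2 * C).
  have A0 : 0 < A by rewrite ltr_pwDl// !mulr_ge0.
  have [n en] : exists n, A * e n <= eps.
    exists (Num.truncn (A / eps)).+1; set n := _.+1.
    rewrite /e exprVn ler_pdivrMr ?exprn_gt0// mulrC -ler_pdivrMr//.
    apply: (le_trans (ltW (truncnS_gt _))); rewrite -/n -natrX ler_nat.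
    exact/ltnW/ltn_expl.
  have := qH n; have := qK n; have := qh n.
  have e1 : e n <= 1 by apply: exprn_ile1; lra.
  have : e n ^+ 2 <= e n by have := e_gt0 n; nra.
  by move: en; rewrite /A; lra.
exists H; split => // h' bh' h'f Nh'; apply: le_trans qHd _.
by apply: d_le; split.
Qed.

End projection.

(** * Truncation in height and support *)

Section truncation.
Context (R : realType).
Notation LT := (lebesgueType R).
Implicit Types (k : LT -> \bar R) (A : set LT).

Definition truncation A (n : nat) k (x : LT) : R :=
  \1_A x * fine (mine `|k x| n%:R%:E)%E.

Lemma truncation_fine (n : nat) (y : \bar R) :
  ((fine (mine `|y| n%:R%:E)%E)%:E = mine `|y| n%:R%:E)%E.
Proof.
rewrite fineK// ge0_fin_numE ?le_min ?abse_ge0 ?lee_fin ?ler0n//.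
by rewrite gt_min ltry orbT.
Qed.

Lemma truncation_ge0 A n k x : 0 <= truncation A n k x.
Proof.
apply: mulr_ge0; first by rewrite indicE.
by rewrite -lee_fin truncation_fine le_min abse_ge0 lee_fin ler0n.
Qed.

Lemma truncation_le A n k x : truncation A n k x <= n%:R.
Proof.
rewrite /truncation indicE; case: (x \in A); rewrite ?mul0r ?mul1r//.
by rewrite -lee_fin truncation_fine ge_min lexx orbT.
Qed.

Lemma truncation_le_abs A n k x : ((truncation A n k x)%:E <= `|k x|)%E.
Proof.
rewrite /truncation indicE; case: (x \in A); rewrite ?mul0r ?mul1r ?abse_ge0//.
by rewrite truncation_fine ge_min lexx.
Qed.

Lemma truncation_nd (A_ : nat -> set LT) k x :
  {homo A_ : m n / (m <= n)%N >-> m `<=` n} ->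
  forall m n, (m <= n)%N -> truncation (A_ m) m k x <= truncation (A_ n) n k x.
Proof.
move=> ndA m n mn; have [Am|nAm] := pselect (A_ m x).
  rewrite /truncation !indicE !mem_set ?mul1r//; last exact: ndA mn _ Am.
  by rewrite -lee_fin !truncation_fine le_min2// lee_fin ler_nat.
by rewrite {1}/truncation indicE memNset// mul0r truncation_ge0.
Qed.

Lemma truncation_sup (A_ : nat -> set LT) k x n0 :
  {homo A_ : m n / (m <= n)%N >-> m `<=` n} -> A_ n0 x ->
  (`|k x| <= ereal_sup (range (fun n => (truncation (A_ n) n k x)%:E)))%E.
Proof.
move=> ndA An0; set s := ereal_sup _.
have sub n : ((truncation (A_ n) n k x)%:E <= s)%E by apply: ereal_sup_ubound; exists n.
rewrite leNgt; apply/negP => sk; move: sub sk; case: s => [r| |] sub sk.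
- pose n := maxn n0 (Num.truncn `|r|).+1.
  have rn : r < n%:R.
    apply: (le_lt_trans (ler_norm r)); apply: (lt_le_trans (truncnS_gt _)).
    by rewrite ler_nat leq_maxr.
  have := sub n; apply/negP; rewrite -ltNge /truncation indicE mem_set ?mul1r; last first.
    by apply: ndA An0; exact: leq_maxl.
  by rewrite truncation_fine lt_min sk lte_fin.
- by move: sk; rewrite ltNge leey.
- by have := sub 0%N; rewrite leeNy_eq.
Qed.

Lemma truncation_bounded (L : \bar R) A n k : measurable A -> mfuns L k ->
  bounded_on L A (truncation A n k).
Proof.
move=> mA mk; split.
- apply: measurable_funM; first exact: measurable_indic.
  apply/measurable_EFinP; rewrite (_ : _ \o _ = fun x => mine `|k x| n%:R%:E)%E.
    by apply: measurable_mine; [exact: mfuns_abs|exact: measurable_cst].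
  by apply/funext => x /=; rewrite truncation_fine.
- exact: truncation_ge0.
- by exists n%:R => x; exact: truncation_le.
- by move=> x nA; rewrite /truncation indicE memNset// mul0r.
Qed.

End truncation.

(** * Separation from the unit ball and the second associate norm *)

Section lorentz_luxemburg.
Context (R : realType) (L : \bar R) (L0 : (0 < L)%E).
Notation LT := (lebesgueType R).
Notation D := (oitv 0 L : set LT).
Context (N : (LT -> \bar R) -> \bar R) (riN : ri_norm L N).

Section bounded_case.
Context (E : set LT) (mE : measurable E) (ED : E `<=` D) (Eoo : (leb E < +oo)%E).
Implicit Types (f g h k : LT -> R).

Notation bdd := (bounded_on L E).
Notation I := (intR L).
Notation Nr F := (N (fun x => (F x)%:E)).

Let bddM F : bdd F -> mfuns_ge0 L (fun x => (F x)%:E).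
Proof. exact: bounded_on_mfuns. Qed.

(* Cutting a competitor off at f decreases its distance to f, so h also minimizes
   among the competitors not bounded by f. *)
Lemma projection_variation f h : bdd f -> bdd h -> (forall x, h x <= f x) ->
  (Nr h <= 1)%E ->
  (forall h', bdd h' -> (forall x, h' x <= f x) -> (Nr h' <= 1)%E ->
    I (fun x => (f x - h x) ^+ 2) <= I (fun x => (f x - h' x) ^+ 2)) ->
  forall k, bdd k -> (Nr k <= 1)%E ->
    I (fun x => (f x - h x) * k x) <= I (fun x => (f x - h x) * h x).
Proof.
move=> bf bh hf Nh minh k bk Nk.
have [mf f0 _ _] := bf; have [mh h0 _ _] := bh; have [mk k0 _ _] := bk.
have bg : bdd (fun x => f x - h x).
  apply: (bounded_on_le bf); first exact: measurable_funB.
  by move=> x; rewrite subr_ge0 hf lerBlDr lerDl h0.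
have bgk := bounded_onM bg bk; have bgh := bounded_onM bg bh.
have bkh := bounded_on_sqrB bk bh; have bfh := bounded_on_sqrB bf bh.
pose K := I (fun x => (k x - h x) ^+ 2).
have K0 : 0 <= K by exact: (intR_ge0 mE ED Eoo).
(* First variation along (1 - s) h + s k: with a and b the two integrals being compared, minimality
   gives 2 s (a - b) <= s^2 K. *)
have step (s : R) : 0 < s <= 1 ->
    I (fun x => (f x - h x) * k x) <= I (fun x => (f x - h x) * h x) + s * K.
  move=> /andP[s0 s1]; have s0' := ltW s0.
  have s1' : 0 <= 1 - s by rewrite subr_ge0.
  pose hs x := (1 - s) * h x + s * k x.
  have bhs : bdd hs by apply: bounded_onD; exact: bounded_onZ.
  have [mhs hs0 _ _] := bhs.
  pose m x := Num.min (hs x) (f x).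
  have bm : bdd m.
    apply: (bounded_on_le bf) => [|x]; first exact: measurable_minr.
    by rewrite le_min hs0 f0 ge_min lexx orbT.
  have Nm : (Nr m <= 1)%E.
    have s01 : 0 <= s <= 1 by rewrite s0'.
    have NhsP : (Nr hs <= 1)%E by exact: (ri_norm_convex riN s01 bh bk Nh Nk).
    apply: le_trans NhsP; apply: (ri_norm_le_bounded riN bm bhs).
    by move=> x; rewrite ge_min lexx.
  have bfm := bounded_on_sqrB bf bm; have bfhs := bounded_on_sqrB bf bhs.
  have q1 : I (fun x => (f x - h x) ^+ 2) <= I (fun x => (f x - hs x) ^+ 2).
    apply: le_trans (minh m bm _ Nm) _; first by move=> x; rewrite ge_min lexx orbT.
    apply: (intR_le mE ED Eoo bfm bfhs) => x; rewrite /m.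
    by case: (leP (hs x) (f x)) => // _; rewrite subrr expr0n sqr_ge0.
  have s20 : 0 <= 2 * s by lra.
  have ss0 : 0 <= s ^+ 2 by rewrite sqr_ge0.
  have bZgk := bounded_onZ s20 bgk; have bZgh := bounded_onZ s20 bgh.
  have bZkh := bounded_onZ ss0 bkh.
  have := intRD mE ED Eoo bfhs bZgk.
  have -> : (fun x => (f x - hs x) ^+ 2 + 2 * s * ((f x - h x) * k x)) =
     (fun x => (f x - h x) ^+ 2 + 2 * s * ((f x - h x) * h x) + s ^+ 2 * (k x - h x) ^+ 2).
    by apply/funext => x; rewrite /hs; ring.
  rewrite (intRD mE ED Eoo (bounded_onD bfh bZgh) bZkh) (intRD mE ED Eoo bfh bZgh).
  rewrite (intRZ mE ED Eoo s20 bgk) (intRZ mE ED Eoo s20 bgh) (intRZ mE ED Eoo ss0 bkh).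
  pose a := I (fun x => (f x - h x) * k x); pose b := I (fun x => (f x - h x) * h x).
  pose qh := I (fun x => (f x - h x) ^+ 2); pose qs := I (fun x => (f x - hs x) ^+ 2).
  rewrite -/K -/a -/b -/qh -/qs => H; rewrite -/qh -/qs in q1.
  move: q1 K0 H; move: qh qs a b K => q q' a b k' q1 k'0 H.
  have : s * (2 * (a - b) - s * k') <= 0 by lra.
  rewrite pmulr_rle0// subr_le0 => H'.
  have sK : 0 <= s * k' by exact: mulr_ge0.
  by lra.
apply/ler_addgt0Pr => eps eps0.
pose s := Num.min 1 (eps / (K + 1)).
have K1 : 0 < K + 1 by lra.
have s0 : 0 < s by rewrite lt_min ltr01 divr_gt0.
apply: le_trans (step s _) _; first by rewrite s0 ge_min lexx.
rewrite lerD2l; apply: (@le_trans _ _ (s * (K + 1))); first by rewrite ler_wpM2l ?ltW//; lra.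
by rewrite -ler_pdivlMr// ge_min lexx orbT.
Qed.

(* With g := f - h, b := int g h and c := int g^2 > 0, g / (b + c) is in the unit
   ball of the associate norm and its pairing with f is 1. *)
Lemma biassoc_bounded f : bdd f -> (1 < Nr f)%E ->
  (1 <= assoc_norm L (assoc_norm L N) (fun x => (f x)%:E))%E.
Proof.
move=> bf Nf; have [h [bh hf Nh minh]] := projection_exists riN mE ED Eoo bf.
have var := projection_variation bf bh hf Nh minh.
have [mf f0 _ _] := bf; have [mh h0 _ _] := bh.
pose g x := f x - h x.
have bg : bdd g.
  apply: (bounded_on_le bf); first exact: measurable_funB.
  by move=> x; rewrite subr_ge0 hf lerBlDr lerDl h0.
have [mg g0 _ gE] := bg.
have bgh := bounded_onM bg bh; have bgg := bounded_onM bg bg.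
pose b := I (fun x => g x * h x); pose c := I (fun x => g x * g x).
have b0 : 0 <= b by exact: (intR_ge0 mE ED Eoo).
(* If c were 0, then f = h almost everywhere and N f <= 1. *)
have c0 : 0 < c.
  rewrite lt_neqAle (intR_ge0 mE ED Eoo bgg) andbT; apply/eqP => c0.
  have := Nf; rewrite ltNge => /negP; apply; apply: le_trans Nh.
  apply: (rin_le riN (bddM bf) (bddM bh)).
  have mgg : measurable_fun D (fun x => (g x * g x)%:E).
    by have [mgg _ _ _] := bgg; exact/measurable_EFinP.
  have i0 : (\int[leb]_(x in D) `|(g x * g x)%:E| = 0)%E.
    transitivity (\int[leb]_(x in D) (g x * g x)%:E)%E.
      by apply: eq_integral => x _; rewrite abse_EFin ger0_norm// mulr_ge0.
    by rewrite -(bounded_onE mE ED Eoo bgg) -/c -c0.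
  have := (ae_eq_integral_abs leb (measurable_oitv 0 L) mgg).1 i0.
  apply: filterS => t H Dt; have := H Dt; rewrite /cst => -[gg0].
  rewrite lee_fin; have : g t = 0 by apply/eqP; rewrite -sqrf_eq0 expr2 gg0.
  by rewrite /g; lra.
have gM := bddM bg.
have g_le : (assoc_norm L N (fun x => (g x)%:E) <= b%:E)%E.
  apply: polar_le => k [k0 Nk]; have [mk _] := k0.
  rewrite (integral_mulabs gM k0).
  (* The variational inequality covers bounded competitors supported in E; a general k is reached by
     truncation, since g vanishes off E. *)
  pose k_ n := truncation E n k.
  have bk_ n : bdd (k_ n) by exact: truncation_bounded.
  have ndE : {homo (fun _ : nat => E) : m n / (m <= n)%N >-> m `<=` n} by move=> m n _ x.
  apply: (@le_trans _ _ (ereal_sup (range (fun n => \int[leb]_(x in D) (g x * k_ n x)%:E)))%E).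
    apply: integral_le_sup.
    - exact: measurable_oitv.
    - by apply: measurable_mulabs; [case: gM|].
    - by move=> x _; rewrite mule_ge0.
    - move=> n; have [mgk _ _ _] := bounded_onM bg (bk_ n).
      exact/measurable_EFinP.
    - by move=> n x _; rewrite lee_fin mulr_ge0// truncation_ge0.
    - move=> x _ i j ij; rewrite lee_fin ler_wpM2l//.
      exact: (truncation_nd k x ndE).
    - move=> x _; have [Ex|nEx] := pselect (E x); last first.
        rewrite gE// abse0 mul0e; apply: (@le_trans _ _ (0 * k_ 0%N x)%:E).
          by rewrite mul0r.
        by apply: ereal_sup_ubound; exists 0%N.
      rewrite muleC; apply: (@le_trans _ _ (ereal_sup (range (fun n => (k_ n x)%:E)) * `|(g x)%:E|)%E).
        by apply: lee_wpmul2r => //; apply: (@truncation_sup _ (fun=> E) k x 0%N).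
      apply: le_trans (ereal_supMr_le _ _) _ => //.
        by move=> n; rewrite lee_fin truncation_ge0.
      apply: ge_ereal_sup => _ [n _ <-]; apply: ereal_sup_ubound; exists n => //.
      by rewrite abse_EFin ger0_norm// muleC.
  apply: ge_ereal_sup => _ [n _ <-].
  rewrite -(bounded_onE mE ED Eoo (bounded_onM bg (bk_ n))) lee_fin; apply: var => //.
  apply: le_trans Nk; rewrite -(ri_norm_abs riN k0).
  apply: (rin_le riN (bddM (bk_ n)) (mfuns_ge0_abs mk)).
  by apply: nearW => x _; exact: truncation_le_abs.
have bc0 : 0 < (b + c)^-1 by rewrite invr_gt0; lra.
have N'ri := assoc_norm_ri_norm L0 riN.
have ball : unit_ball L (assoc_norm L N) (fun x => ((b + c)^-1)%:E * (g x)%:E)%E.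
  split; first exact: mfuns_ge0_scale (ltW bc0) gM.
  rewrite (rin_scale N'ri (ltW bc0) gM).
  apply: le_trans (lee_wpmul2l _ g_le) _; first by rewrite lee_fin ltW.
  by rewrite -EFinM lee_fin mulrC ler_pdivrMr; lra.
apply: le_trans (polar_ub L (fun x => (f x)%:E) ball).
rewrite integral_mulC (integral_mulZ (ltW bc0) gM (bddM bf)).
have -> : (\int[leb]_(x in D) ((g x)%:E * (f x)%:E) = (b + c)%:E)%E.
  transitivity (\int[leb]_(x in D) (g x * h x + g x * g x)%:E)%E.
    by apply: eq_integral => x _; rewrite -EFinM -mulrDr /g subrKC.
  by rewrite -(bounded_onE mE ED Eoo (bounded_onD bgh bgg)) (intRD mE ED Eoo bgh bgg).
by rewrite -EFinM mulVf// gt_eqF//; lra.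
Qed.

End bounded_case.

Local Open Scope ereal_scope.

(** If N f exceeded N'' f, then by (P3) so would N of some truncation. The bounded case yields only
    a weak inequality, so the truncation is divided by a c strictly between the two values. *)
Lemma lorentz_luxemburg f : mfuns_ge0 L f ->
  N f <= assoc_norm L (assoc_norm L N) f.
Proof.
move=> fM; have [mf _] := fM.
have N'ri := assoc_norm_ri_norm L0 riN; have N''ri := assoc_norm_ri_norm L0 N'ri.
set N'' := assoc_norm L (assoc_norm L N) in N''ri *.
rewrite leNgt; apply/negP => cN.
pose E n : set LT := D `&` oitv 0 n%:R%:E.
have mE n : measurable (E n) by apply: measurableI; exact: measurable_oitv.
have ED n : E n `<=` D by move=> x [].
have Eoo n : leb (E n) < +oo by apply: (@leb_bounded_lty _ n%:R) => // x [].
have ndE : {homo E : m n / (m <= n)%N >-> m `<=` n}.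
  move=> m n mn x [Dx /andP[x0 xm]]; split => //; apply/andP; split => //.
  by rewrite (lt_le_trans xm)// lee_fin ler_nat.
pose f_ n x := (truncation (E n) n f x)%:E.
have bf_ n : bounded_on L (E n) (truncation (E n) n f) by exact: truncation_bounded.
have f_M n : mfuns_ge0 L (f_ n) by exact: bounded_on_mfuns (bf_ n).
have f_f n x : f_ n x <= `|f x| by exact: truncation_le_abs.
have [_ Nf_] : (forall m n, (m <= n)%N -> N (f_ m) <= N (f_ n)) /\
    N (f_ k) @[k --> \oo] --> N (fun x => `|f x|).
  apply: (rin_fatou riN f_M (mfuns_ge0_abs mf)); apply: nearW => t Dt.
  have ndf : {homo f_ ^~ t : m n / (m <= n)%N >-> m <= n}.
    by move=> m n mn; rewrite lee_fin; exact: truncation_nd.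
  split; first exact: ndf.
  have -> : `|f t| = ereal_sup (range (f_ ^~ t)).
    apply/eqP; rewrite eq_le; apply/andP; split; last first.
      by apply: ge_ereal_sup => _ [n _ <-]; exact: f_f.
    apply: (@truncation_sup _ E f t (Num.truncn (`|t : R|)%R).+1) => //.
    split => //; have /andP[t0 _] := Dt; apply/andP; split => //.
    by rewrite lte_fin (le_lt_trans (ler_norm _))// truncnS_gt.
  exact: ereal_nondecreasing_cvgn.
rewrite (ri_norm_abs riN fM) in Nf_.
have [n Nn] : exists n, N'' f < N (f_ n).
  apply: contrapT => H; move: cN; apply/negP; rewrite -leNgt.
  rewrite -(cvg_lim (@ereal_hausdorff _) Nf_); apply: lime_le.
    by apply/cvg_ex; eexists; exact: Nf_.
  by apply: nearW => n; rewrite leNgt; apply/negP => H'; apply: H; exists n.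
have [c c_gt0 /andP[Nc cn]] : exists2 c : R, (0 < c)%R & N'' f < c%:E < N (f_ n).
  have N''f0 := rin_ge0 N''ri fM.
  have fin : N'' f \is a fin_num by rewrite ge0_fin_numE// (lt_le_trans Nn)// leey.
  move: Nn N''f0; rewrite -(fineK fin); case: (N (f_ n)) => [r| |]//.
  - rewrite !lte_fin !lee_fin => ar a0; exists ((fine (N'' f) + r) / 2)%R; first by lra.
    by rewrite !lte_fin; apply/andP; split; lra.
  - move=> _; rewrite lee_fin => a0; exists (fine (N'' f) + 1)%R; first by lra.
    by rewrite lte_fin ltry andbT; lra.
have ci0 : (0 <= c^-1)%R by rewrite invr_ge0 ltW.
have bcf : bounded_on L (E n) (fun x => c^-1 * truncation (E n) n f x)%R.
  exact: bounded_onZ.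
have /(biassoc_bounded (mE n) (ED n) (Eoo n) bcf) :
    1 < N (fun x => (c^-1 * truncation (E n) n f x)%:E).
  rewrite (rin_scale riN ci0 (f_M n)).
  move: cn; case: (N (f_ n)) => [r| |]//.
  - by rewrite lte_fin -EFinM lte_fin => cr; rewrite mulrC ltr_pdivlMr// mul1r.
  - by move=> _; rewrite gt0_muley ?ltry// lte_fin invr_gt0.
rewrite -/N'' (rin_scale N''ri ci0 (f_M n)) lee_pdivlMl// mule1 => cN''.
move: Nc; apply/negP; rewrite -leNgt; apply: (le_trans cN'').
apply: (rin_le N''ri) => //.
by apply: filterS (mfuns_ge0_abs_ae fM) => t H Dt; rewrite -H.
Qed.

End lorentz_luxemburg.

(** * The operator and its dual *)

Local Open Scope ereal_scope.

Lemma integral_gt0 d (T : measurableType d) (R : realType)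
    (mu : {measure set T -> \bar R}) (A : set T) (w : T -> \bar R) :
  measurable A -> measurable_fun A w -> (forall x, A x -> 0 < w x) -> 0 < mu A ->
  0 < \int[mu]_(x in A) w x.
Proof.
move=> mA mw w0 A0; rewrite lt0e; apply/andP; split; last first.
  by apply: integral_ge0 => x /w0/ltW.
apply/eqP => i0.
have i0' : \int[mu]_(x in A) `|w x| = 0.
  by rewrite -i0; apply: eq_integral => x; rewrite inE => /w0/ltW/gee0_abs.
have [N [mN N0 subN]] := (ae_eq_integral_abs mu mA mw).1 i0'.
move: A0; rewrite -N0 ltNge => /negP; apply; apply: le_measure; rewrite ?inE//.
by move=> x Ax; apply: subN => /= H; have := w0 x Ax; rewrite H// ltxx.
Qed.

Section fubini_sections.
Context (R : realType).
Notation LT := (lebesgueType R).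

Lemma fubini_sections (D : set LT) (a b : LT -> \bar R) (A : set (LT * LT)) :
  measurable D -> measurable_fun D a -> measurable_fun D b ->
  (forall x, D x -> 0 <= a x) -> (forall x, D x -> 0 <= b x) -> measurable A ->
  \int[leb]_(t in D) (b t * \int[leb]_(s in D `&` [set s | A (t, s)]) a s) =
  \int[leb]_(s in D) (a s * \int[leb]_(t in D `&` [set t | A (t, s)]) b t).
Proof.
move=> mD ma mb a0 b0 mA.
have ma1 : measurable_fun setT (a \_ D) by exact/(measurable_restrictT _ _).1.
have mb1 : measurable_fun setT (b \_ D) by exact/(measurable_restrictT _ _).1.
have a10 x : 0 <= (a \_ D) x by apply: erestrict_ge0.
have b10 x : 0 <= (b \_ D) x by apply: erestrict_ge0.
pose F z := (b \_ D) z.1 * ((a \_ D) z.2 * (\1_A z : R)%:E).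
have mF : measurable_fun setT F.
  apply: emeasurable_funM; first exact: (measurableT_comp mb1 measurable_fst).
  apply: emeasurable_funM; first exact: (measurableT_comp ma1 measurable_snd).
  exact: measurable_eindic.
have F0 z : 0 <= F z by rewrite !mule_ge0// lee_fin.
have mx t : measurable_fun setT (fun s : LT => (\1_A (t, s) : R)%:E).
  exact: (measurableT_comp (@measurable_eindic _ _ R _ setT mA) (pair1_measurable t)).
have my s : measurable_fun setT (fun t : LT => (\1_A (t, s) : R)%:E).
  exact: (measurableT_comp (@measurable_eindic _ _ R _ setT mA) (pair2_measurable s)).
have inner (B : set LT) (c : LT -> \bar R) : \int[leb]_(s in D `&` B) c s =
    \int[leb]_s ((c \_ D) s * (\1_B s : R)%:E).
  rewrite integral_mkcond; apply: eq_integral => s _.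
  rewrite !patchE indicE in_setI; have [sD|sD] := boolP (s \in D).
    by case: (s \in B); rewrite ?mule1 ?mule0.
  by rewrite /= mul0e.
have := @fubini_tonelli _ _ LT LT R leb leb F mF F0.
have -> : (fun t => \int[leb]_s F (t, s)) =
    (fun t => b t * \int[leb]_(s in D `&` [set s | A (t, s)]) a s) \_ D.
  apply/funext => t; rewrite /F /=.
  have m1 : measurable_fun setT (fun s => (a \_ D) s * (\1_A (t, s) : R)%:E).
    exact: emeasurable_funM.
  have n1 s : 0 <= (a \_ D) s * (\1_A (t, s) : R)%:E by rewrite mule_ge0// lee_fin.
  rewrite (@ge0_integralZl _ LT R leb setT measurableT _ m1 _ (fun s _ => n1 s) (b10 t)).
  rewrite [RHS]patchE inner patchE; case: ifPn => [_|_]; last by rewrite mul0e.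
  by congr (_ * _); apply: eq_integral => s _.
have -> : (fun s => \int[leb]_t F (t, s)) =
    (fun s => a s * \int[leb]_(t in D `&` [set t | A (t, s)]) b t) \_ D.
  apply/funext => s; rewrite /F /=.
  have m1 : measurable_fun setT (fun t => (b \_ D) t * (\1_A (t, s) : R)%:E).
    exact: emeasurable_funM.
  have n1 t : 0 <= (b \_ D) t * (\1_A (t, s) : R)%:E by rewrite mule_ge0// lee_fin.
  transitivity (\int[leb]_t ((a \_ D) s * ((b \_ D) t * (\1_A (t, s) : R)%:E))).
    by apply: eq_integral => t _; rewrite muleCA.
  rewrite (@ge0_integralZl _ LT R leb setT measurableT _ m1 _ (fun t _ => n1 t) (a10 s)).
  rewrite [RHS]patchE inner patchE; case: ifPn => [_|_]; last by rewrite mul0e.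
  by congr (_ * _); apply: eq_integral => t _.
by rewrite -!integral_mkcond.
Qed.

End fubini_sections.

Section weighted_operator.
Context (R : realType) (L : \bar R) (L0 : 0 < L).
Notation LT := (lebesgueType R).
Notation D := (oitv 0 L : set LT).
Context (nu : R -> R) (nu_bij : set_bij (oitv 0 L) (oitv 0 L) nu)
  (nu_incr : {in oitv 0 L &, {homo nu : s t / (s < t)%R}}).
Context (u : R -> R) (u_gt0 : forall t, oitv 0 L t -> (0 < u t)%R)
  (u_nondeg : nondeg_weight L u)
  (u_noninc : {in oitv 0 L &, {homo u : s t / (s <= t)%R >-> (s >= t)%R}}).
Context (v : R -> R) (v_gt0 : forall t, oitv 0 L t -> (0 < v t)%R)
  (v_meas : measurable_fun (oitv 0 L : set LT) (v : LT -> R)).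
Notation inv := (pinv (oitv 0 L) nu).
Notation H := (Hop L u v nu).
Implicit Types (f g h k : LT -> \bar R).

Lemma inv_in t : D t -> D (inv t).
Proof.
move=> Dt; have [_ _ /(_ t Dt)[s Ds <-]] := nu_bij; have [_ inj _] := nu_bij.
by rewrite pinvKV ?inE//.
Qed.

Lemma invK t : D t -> nu (inv t) = t.
Proof.
by move=> Dt; have [_ inj /(_ t Dt)[s Ds <-]] := nu_bij; rewrite pinvKV ?inE.
Qed.

Lemma nu_in t : D t -> D (nu t).
Proof. by have [fn _ _] := nu_bij; exact: fn. Qed.

Lemma nu_lt s t : D s -> D t -> (nu s < nu t)%R = (s < t)%R.
Proof.
move=> Ds Dt; apply/idP/idP => [|st]; last by apply: nu_incr => //; rewrite inE.
apply: contraTT; rewrite -!leNgt le_eqVlt => /predU1P[->//|ts].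
by rewrite ltW// nu_incr// inE.
Qed.

(** Describes the region of integration from both sides: s in (0, nu^-1(t)) exactly when t in
    (nu(s), L). *)
Lemma lt_inv s t : D s -> D t -> (s < inv t)%R = (nu s < t)%R.
Proof. by move=> Ds Dt; rewrite -{2}(invK Dt) nu_lt//; exact: inv_in. Qed.

Lemma inv_le s t : D s -> D t -> (s <= t)%R -> (inv s <= inv t)%R.
Proof.
move=> Ds Dt st; rewrite leNgt lt_inv//; last exact: inv_in.
by rewrite invK// -leNgt.
Qed.

Lemma itv_sub t : D t -> `]0%R, t[%classic `<=` (oitv 0 L : set R).
Proof.
move=> /andP[t0 tL] s; rewrite /= in_itv/= => /andP[s0 st].
by apply/andP; rewrite !lte_fin; split => //; apply: lt_trans tL; rewrite lte_fin.
Qed.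

Lemma measurable_itvo (a b : R) : measurable (`]a, b[%classic : set LT).
Proof. by apply: measurable_interval; exact: interval_is_interval. Qed.

Lemma oitv_sub (a b : R) : (a <= b)%R -> oitv b L `<=` (oitv a L : set R).
Proof.
by move=> ab s /andP[bs sL]; apply/andP; split => //; apply: le_lt_trans bs; rewrite lee_fin.
Qed.

Lemma measurable_u : measurable_fun D (fun s : LT => (u s)%:E).
Proof.
apply: measurable_nonincreasing; first exact: oitv_interval.
by move=> x y Dx Dy xy; rewrite lee_fin u_noninc// inE.
Qed.

Lemma measurable_v : measurable_fun D (fun s : LT => (v s)%:E).
Proof. exact/measurable_EFinP. Qed.

Lemma measurable_Hop_body g : mfuns L g -> measurable_fun D (fun s => `|g s| * (v s)%:E).
Proof. by move=> mg; apply: emeasurable_funM; [exact: mfuns_abs|exact: measurable_v]. Qed.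

Lemma Hop_body_ge0 g s : D s -> 0 <= `|g s| * (v s)%:E.
Proof. by move=> Ds; rewrite mule_ge0// lee_fin ltW// v_gt0. Qed.

Lemma Hop_ge0 g s : D s -> 0 <= H g s.
Proof.
move=> Ds; rewrite /Hop mule_ge0//; first by rewrite lee_fin ltW// u_gt0.
apply: integral_ge0 => x /(oitv_sub _) Dx; apply: Hop_body_ge0; apply: Dx.
by have /andP[] := nu_in Ds; rewrite lte_fin => /ltW.
Qed.

Lemma nu_ge0 s : D s -> (0 <= nu s)%R.
Proof. by move=> /nu_in/andP[]; rewrite lte_fin => /ltW. Qed.

(** Both factors decrease. Hence integrating a rearrangement against H g gives [rearr_pairing]
    exactly. *)
Lemma Hop_nonincreasing g : mfuns L g ->
  forall s t, oitv 0 L s -> oitv 0 L t -> (s <= t)%R -> H g t <= H g s.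
Proof.
move=> mg s t Ds Dt st; apply: lee_pmul.
- by rewrite lee_fin ltW// u_gt0.
- apply: integral_ge0 => x /(oitv_sub (nu_ge0 Dt)); exact: Hop_body_ge0.
- by rewrite lee_fin u_noninc// inE.
apply: ge0_subset_integral.
- exact: measurable_oitv.
- exact: measurable_oitv.
- apply: measurable_funS (measurable_Hop_body mg); first exact: measurable_oitv.
  exact: oitv_sub (nu_ge0 Ds).
- by move=> x /(oitv_sub (nu_ge0 Ds)); exact: Hop_body_ge0.
- apply: oitv_sub; move: st; rewrite le_eqVlt => /predU1P[->//|st].
  by rewrite ltW// nu_lt.
Qed.

Lemma mfuns_ge0_Hop g : mfuns L g -> mfuns_ge0 L (H g).
Proof.
move=> mg; apply: mfuns_ge0_of; last by move=> s; exact: Hop_ge0.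
by apply: mfuns_nonincreasing; exact: Hop_nonincreasing.
Qed.

Lemma Hop_abs g : H (fun s => `|g s|) = H g.
Proof.
by apply/funext => t; rewrite /Hop; congr (_ * _); apply: eq_integral => s _; rewrite abse_id.
Qed.

(** The formal adjoint of H applied to the rearrangement of f; its X'-norm is
    [target_assoc_norm]. *)
Definition dual_op f (t : LT) : \bar R := (v t)%:E *
  \int[leb]_(s in (`]0%R, inv t[%classic : set LT)) (rearr L f s * (u s)%:E).

Lemma measurable_rearr_u f : measurable_fun D (fun s => rearr L f s * (u s)%:E).
Proof.
by apply: emeasurable_funM; [exact: mfuns_rearr|exact: measurable_u].
Qed.

Lemma rearr_u_ge0 f s : D s -> 0 <= rearr L f s * (u s)%:E.
Proof. by move=> Ds; rewrite mule_ge0 ?rearr_ge0// lee_fin ltW// u_gt0. Qed.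

Lemma mfuns_ge0_dual_op f : mfuns_ge0 L (dual_op f).
Proof.
apply: mfuns_ge0_of; last first.
  move=> t Dt; rewrite mule_ge0//; first by rewrite lee_fin ltW// v_gt0.
  by apply: integral_ge0 => s /(itv_sub (inv_in Dt)); exact: rearr_u_ge0.
apply: emeasurable_funM; first exact: measurable_v.
apply: measurable_nondecreasing; first exact: oitv_interval.
move=> x y Dx Dy xy; apply: ge0_subset_integral.
- exact: measurable_itvo.
- exact: measurable_itvo.
- apply: measurable_funS (measurable_rearr_u f); first exact: measurable_oitv.
  exact: itv_sub (inv_in Dy).
- by move=> s /(itv_sub (inv_in Dy)); exact: rearr_u_ge0.
- move=> s; rewrite /= !in_itv/= => /andP[-> sx]/=.
  by apply: lt_le_trans sx _; exact: inv_le.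
Qed.

Lemma dual_op_duality f g : mfuns L f -> mfuns_ge0 L g ->
  \int[leb]_(t in D) (dual_op f t * g t) = rearr_pairing L f (H g).
Proof.
move=> mf g0; have [mg _] := g0.
rewrite -(rearr_pairing_nonincreasing (ltW L0) mf (@Hop_ge0 g) (Hop_nonincreasing mg)).
(* [nu] is arbitrary off (0, L); replacing it there by 0 makes the set measurable in the plane, and
   the integrals see only points of [D]. *)
pose A : set (LT * LT) := [set z | (fun s : LT => (nu s)%:E) \_ D z.2 < (z.1 : R)%:E].
have mA : measurable A.
  rewrite -[A]setTI; apply: measurable_lte => //.
    have mnu : measurable_fun D (fun s : LT => (nu s)%:E).
      apply: measurable_nondecreasing; first exact: oitv_interval.
      move=> x y Dx Dy; rewrite le_eqVlt => /predU1P[->//|xy].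
      by rewrite lee_fin ltW// nu_lt.
    have := (measurable_restrictT _ (measurable_oitv 0 L)).1 mnu.
    by move=> /measurableT_comp; apply; exact: measurable_snd.
  have mid : measurable_fun setT (fun z : LT => (z : R)%:E).
    by apply: measurable_nondecreasing => // x y _ _; rewrite lee_fin.
  exact: (measurableT_comp mid measurable_fst).
have := @fubini_sections R D (fun s => rearr L f s * (u s)%:E)
  (fun t => `|g t| * (v t)%:E) A (measurable_oitv 0 L) (measurable_rearr_u f)
  (measurable_Hop_body mg) (@rearr_u_ge0 f) (@Hop_body_ge0 g) mA => FS.
transitivity (\int[leb]_(t in D) (dual_op f t * `|g t|)).
  apply: ae_eq_integral.
  - exact: measurable_oitv.
  - by apply: emeasurable_funM; [have [] := mfuns_ge0_dual_op f|].
  - by apply: emeasurable_funM; [have [] := mfuns_ge0_dual_op f|exact: mfuns_abs].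
  - by apply: filterS (mfuns_ge0_abs_ae g0) => t Ht Dt; rewrite Ht.
transitivity (\int[leb]_(t in D) (`|g t| * (v t)%:E *
    \int[leb]_(s in D `&` [set s | A (t, s)]) (rearr L f s * (u s)%:E))).
  apply: eq_integral => t; rewrite inE => Dt.
  rewrite /dual_op muleC muleA; congr (_ * integral _ _ _).
  apply/seteqP; split => [s st|s [Ds]].
    have Ds := itv_sub (inv_in Dt) st; split => //.
    move: st; rewrite /A /= in_itv/= patchE mem_set// lte_fin => /andP[_].
    by rewrite lt_inv.
  rewrite /A /= in_itv/= patchE mem_set// lte_fin -lt_inv// => ->.
  by have /andP[+ _] := Ds; rewrite lte_fin => ->.
rewrite FS; apply: eq_integral => s; rewrite inE => Ds.
rewrite /Hop muleA; congr (_ * integral _ _ _).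
apply/seteqP; split => [t [Dt]|t st].
  rewrite /A /= patchE mem_set// => st; have /andP[_ tL] := Dt.
  by apply/andP; split.
have Dt := oitv_sub (nu_ge0 Ds) st; split => //.
by rewrite /A /= patchE mem_set//; have /andP[] := st.
Qed.


(** * The primitive U and the dual operator on indicators *)

Notation U := (weight_int u).

Lemma measurable_u_itv t : D t ->
  measurable_fun (`]0%R, t[%classic : set LT) (fun s => (u s)%:E).
Proof.
by move=> Dt; apply: measurable_funS measurable_u; [exact: measurable_oitv|exact: itv_sub].
Qed.

Lemma u_itv_ge0 t s : D t -> `]0%R, t[%classic s -> 0 <= (u s)%:E.
Proof. by move=> Dt /(itv_sub Dt) Ds; rewrite lee_fin ltW// u_gt0. Qed.

Lemma weight_int_ge0 t : D t -> 0 <= U t.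
Proof. by move=> Dt; apply: integral_ge0 => s; exact: u_itv_ge0. Qed.

Lemma weight_int_le s t : D t -> (s <= t)%R -> U s <= U t.
Proof.
move=> Dt st; apply: ge0_subset_integral.
- exact: measurable_itvo.
- exact: measurable_itvo.
- exact: measurable_u_itv.
- by move=> x; exact: u_itv_ge0.
- by move=> x; rewrite /= !in_itv/= => /andP[-> xs]; exact: lt_le_trans st.
Qed.

Lemma weight_int_gt0 t : D t -> 0 < U t.
Proof.
move=> Dt; apply: integral_gt0.
- exact: measurable_itvo.
- exact: measurable_u_itv.
- by move=> s /(itv_sub Dt) Ds; rewrite lte_fin u_gt0.
- have /andP[t0 _] := Dt.
  by change (0 < leb (`]0%R, t[%classic : set LT)); rewrite leb_itv/= t0 oppr0 adde0.
Qed.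

(** Nondegeneracy gives finiteness at one point t0; beyond it u is bounded by u(t0). *)
Lemma weight_int_lty t : D t -> U t < +oo.
Proof.
move=> Dt; have [t0 Dt0 /andP[_ Ut0]] := u_nondeg.
have [tt0|t0t] := leP t t0; first by apply: le_lt_trans Ut0; exact: weight_int_le.
have /andP[t00 _] := Dt0; rewrite lte_fin in t00.
pose B : set LT := `[t0, t[%classic.
have mB : measurable B by apply: measurable_interval; exact: interval_is_interval.
have BD : B `<=` D.
  move=> s; rewrite /B/= in_itv/= => /andP[t0s st]; apply: (itv_sub Dt).
  by rewrite /= in_itv/= st andbT (lt_le_trans t00).
have UE : `]0%R, t[%classic = `]0%R, t0[%classic `|` B.
  apply/seteqP; split => s; rewrite /B/= !in_itv/=.
    by move=> /andP[s0 st]; have [ss|ss] := ltP s t0; [left|right]; rewrite ?s0 ?st.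
  move=> [/andP[-> st0]|/andP[t0s ->]]/=; first exact: lt_trans t0t.
  by rewrite (lt_le_trans t00)//=.
have -> : U t = U t0 + \int[leb]_(s in B) (u s)%:E.
  rewrite /weight_int UE; apply: ge0_integral_setU.
  - exact: measurable_itvo.
  - exact: mB.
  - by rewrite -UE; exact: measurable_u_itv.
  - by rewrite -UE => s; exact: u_itv_ge0.
  - rewrite disj_set2E; apply/eqP/seteqP; split => // s [].
    by rewrite /B/= !in_itv/= => /andP[_ st0] /andP[t0s _]; move: st0; rewrite ltNge t0s.
rewrite lte_add_pinfty//; apply: (@le_lt_trans _ _ (\int[leb]_(s in B) cst (u t0)%:E s)).
  apply: ge0_le_integral.
  - exact: mB.
  - by move=> s /BD Ds; rewrite lee_fin ltW// u_gt0.
  - by apply: measurable_funS measurable_u => //; exact: measurable_oitv.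
  - exact: measurable_cst.
  - move=> s Bs; rewrite lee_fin u_noninc ?inE//; first exact: BD.
    by move: Bs; rewrite /B/= in_itv/= => /andP[].
rewrite integral_cst//; apply: lte_mul_pinfty => //; first by rewrite lee_fin ltW// u_gt0.
by change (leb B < +oo); rewrite leb_itv/=; case: ifP => _; rewrite -?EFinB ltry.
Qed.

Lemma superlevel_scaled_indic (E : set LT) (c l : R) : E `<=` D -> (0 <= c)%R ->
  (0 <= l)%R -> superlevel L (fun t => c%:E * (\1_E t : R)%:E) l =
    if (l < c)%R then E else set0.
Proof.
move=> ED c0 l0; apply/seteqP; split => [x [Dx /=]|x].
  rewrite indicE; have [xE|xE] := boolP (x \in E); last first.
    by rewrite mulr0 normr0 lte_fin ltNge l0.
  by rewrite mulr1 ger0_norm// lte_fin => ->; rewrite inE in xE.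
case: ifP => // lc Ex; split; first exact: ED.
by rewrite /= indicE mem_set// mulr1 ger0_norm.
Qed.

Lemma distr_fun_indic (E : set LT) (l : R) : E `<=` D -> (0 <= l)%R ->
  distr_fun L (fun t => (\1_E t : R)%:E) l = if (l < 1)%R then leb E else 0.
Proof.
move=> ED l0; have := superlevel_scaled_indic ED ler01 l0.
under [X in superlevel L X]eq_fun do rewrite mul1e.
by rewrite -superlevelE => ->; case: ifP => _; rewrite ?measure0.
Qed.

Lemma rearr_indic_le1 (E : set LT) s : measurable E -> E `<=` D -> (0 <= s)%R ->
  rearr L (fun t => (\1_E t : R)%:E) s <= 1.
Proof.
move=> mE ED s0; have mf := (@mfuns_ge0_indic R L E mE).1.
by rewrite leNgt (rearr_gt s mf ler01) distr_fun_indic// ltxx lte_fin ltNge s0.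
Qed.

Lemma rearr_indic_ge1 (E : set LT) s : measurable E -> E `<=` D -> s%:E < leb E ->
  1 <= rearr L (fun t => (\1_E t : R)%:E) s.
Proof.
move=> mE ED sE; have mf := (@mfuns_ge0_indic R L E mE).1.
rewrite leNgt; apply/negP; set y := rearr _ _ _ => y1.
have y0 : 0 <= y by exact: rearr_ge0.
have yfin : y \is a fin_num by rewrite ge0_fin_numE// (lt_trans y1)// ltry.
move: y1 y0; rewrite -(fineK yfin) lte_fin lee_fin => y1 y0.
have := rearr_gt s mf y0; rewrite distr_fun_indic// y1 sE (fineK yfin).
by rewrite /y ltxx.
Qed.

Lemma rearr_indic_eq0 (E : set LT) s : measurable E -> E `<=` D -> leb E <= s%:E ->
  rearr L (fun t => (\1_E t : R)%:E) s = 0.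
Proof.
move=> mE ED Es; have mf := (@mfuns_ge0_indic R L E mE).1.
apply/eqP; rewrite eq_le rearr_ge0 andbT leNgt (rearr_gt s mf (lexx _)).
by rewrite distr_fun_indic// ltr01 -leNgt.
Qed.

(* The next three estimates compare xi with the value of the target norm at the
   indicator of E through (1_E)^* = 1_(0, |E|). *)
Lemma dual_op_indic_le (E : set LT) t : measurable E -> E `<=` D -> D t ->
  dual_op (fun t => (\1_E t : R)%:E) t <= (v t)%:E * U (inv t).
Proof.
move=> mE ED Dt; have Di := inv_in Dt.
apply: lee_wpmul2l; first by rewrite lee_fin ltW// v_gt0.
apply: ge0_le_integral.
- exact: measurable_itvo.
- by move=> s /(itv_sub Di); exact: rearr_u_ge0.
- apply: measurable_funS (measurable_rearr_u _); first exact: measurable_oitv.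
  exact: itv_sub.
- exact: measurable_u_itv.
- move=> s si; rewrite -[leRHS]mul1e; apply: lee_wpmul2r; first exact: u_itv_ge0 si.
  apply: rearr_indic_le1 => //.
  by move: si; rewrite /= in_itv/= => /andP[/ltW].
Qed.

Lemma dual_op_indic_le_cst (E : set LT) (e : R) t : measurable E -> E `<=` D -> D t ->
  D e -> leb E <= e%:E -> dual_op (fun t => (\1_E t : R)%:E) t <= (v t)%:E * U e.
Proof.
move=> mE ED Dt De Ee; have Di := inv_in Dt.
apply: lee_wpmul2l; first by rewrite lee_fin ltW// v_gt0.
apply: (@le_trans _ _ (\int[leb]_(s in (`]0%R, inv t[%classic `&` `]0%R, e[%classic : set LT)) (u s)%:E)).
  rewrite integral_mkcondr; apply: ge0_le_integral.
  - exact: measurable_itvo.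
  - by move=> s /(itv_sub Di); exact: rearr_u_ge0.
  - apply: measurable_funS (measurable_rearr_u _); first exact: measurable_oitv.
    exact: itv_sub.
  - apply: (measurable_restrict _ (measurable_itvo 0 e) (measurable_itvo 0 (inv t))).1.
    apply: measurable_funS (measurable_u_itv Di); first exact: measurable_itvo.
    by move=> s [].
  - move=> s si; have /andP[s0 _] : (0 < s < inv t)%R by move: si; rewrite /= in_itv.
    rewrite patchE; case: ifPn => [_|].
      rewrite -[leRHS]mul1e; apply: lee_wpmul2r; first exact: u_itv_ge0 si.
      by apply: rearr_indic_le1 => //; exact: ltW.
    rewrite notin_setE /= in_itv/= s0/= => /negP; rewrite -leNgt => es.
    by rewrite rearr_indic_eq0 ?mul0e// (le_trans Ee)// lee_fin.
apply: ge0_subset_integral.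
- by apply: measurableI; exact: measurable_itvo.
- exact: measurable_itvo.
- exact: measurable_u_itv.
- by move=> x; exact: u_itv_ge0.
- by move=> x [].
Qed.

Lemma dual_op_indic_ge (E : set LT) (r : R) t : measurable E -> E `<=` D -> D t ->
  (r <= inv t)%R -> r%:E <= leb E ->
  (v t)%:E * U r <= dual_op (fun t => (\1_E t : R)%:E) t.
Proof.
move=> mE ED Dt rt rE; have Di := inv_in Dt.
have sub : `]0%R, r[%classic `<=` (`]0%R, inv t[%classic : set R).
  by move=> x; rewrite /= !in_itv/= => /andP[-> xr]; exact: lt_le_trans rt.
have mr : measurable_fun (`]0%R, inv t[%classic : set LT)
    (fun s => rearr L (fun t => (\1_E t : R)%:E) s * (u s)%:E).
  apply: measurable_funS (measurable_rearr_u _); first exact: measurable_oitv.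
  exact: itv_sub.
apply: lee_wpmul2l; first by rewrite lee_fin ltW// v_gt0.
apply: (@le_trans _ _ (\int[leb]_(s in (`]0%R, r[%classic : set LT))
    (rearr L (fun t => (\1_E t : R)%:E) s * (u s)%:E))).
  apply: ge0_le_integral.
  - exact: measurable_itvo.
  - by move=> s /sub; exact: u_itv_ge0.
  - by apply: measurable_funS (measurable_u_itv Di) => //; exact: measurable_itvo.
  - by apply: measurable_funS mr => //; exact: measurable_itvo.
  - move=> s sr; rewrite -[leLHS]mul1e; apply: lee_wpmul2r.
      by apply: (u_itv_ge0 Di); exact: sub.
    apply: rearr_indic_ge1 => //; apply: lt_le_trans rE.
    by move: sr; rewrite /= in_itv/= lte_fin => /andP[].
apply: ge0_subset_integral => //.
- exact: measurable_itvo.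
- exact: measurable_itvo.
- by move=> s /(itv_sub Di); exact: rearr_u_ge0.
Qed.


(** * The target norm, optimality and the condition on xi *)

Context (NX : (LT -> \bar R) -> \bar R) (hX : ri_norm L NX).
Notation X' := (assoc_norm L NX).
Notation target := (target_assoc_norm L u v nu NX).
Notation ball := (unit_ball L NX).
Let riX' : ri_norm L X' := assoc_norm_ri_norm L0 hX.

Definition range_hull : set (LT -> \bar R) := [set h | mfuns_ge0 L h /\
  exists2 g, ball g & forall l, (0 < l)%R -> distr_fun L h l <= distr_fun L (H g) l].

Lemma range_hull_solid : rearr_solid L range_hull.
Proof.
split => [h []//|h h' [h0 [g bg hg]] h'0 h'h]; split => //; exists g => // l l0.
by apply: le_trans (hg l l0); exact: h'h.
Qed.

Lemma range_hull_Hop g : ball g -> range_hull (H g).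
Proof. by move=> bg; split; [case: bg => -[mg _] _; exact: mfuns_ge0_Hop|exists g]. Qed.

(** Both sides are the supremum of [rearr_pairing] of f and H g over g in the unit ball: the left by
    duality, the right by resonance and Hardy-Littlewood. *)
Lemma target_polar f : mfuns_ge0 L f -> target f = polar L range_hull f.
Proof.
move=> f0; have [mf _] := f0; apply/eqP; rewrite eq_le; apply/andP; split.
  apply: polar_le => g bg; rewrite dual_op_duality//; last by case: bg.
  by apply: polar_pairing_ge range_hull_solid f0 _; exact: range_hull_Hop.
apply: polar_le => h [h0 [g bg hg]]; have [mh _] := h0.
have [g0 _] := bg; have [mg _] := g0.
apply: (le_trans (integral_mul_pairing f0 h0)).
have [mH _] := mfuns_ge0_Hop mg.
apply: (le_trans (rearr_pairing_le mf mh mH hg)).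
by rewrite -dual_op_duality//; exact: polar_ub.
Qed.

(** A multiple of the indicator of a bounded interval starting at nu(r) has H g(r) > 0, and
    monotonicity carries the lower bound to (0, r]. *)
Lemma Hop_gt_indic (r : R) : D r -> exists g c, [/\ ball g, (0 < c)%R &
  forall s, D s -> (s <= r)%R -> c%:E < H g s].
Proof.
move=> Dr; have Dn := nu_in Dr; have /andP[n0 nL] := Dn.
have [b nb bL] : exists2 b : R, (nu r < b)%R & b%:E <= L.
  case: L nL => [l| |]//; last by exists (nu r + 1)%R; rewrite ?ltrDl// leey.
  by rewrite lte_fin => nl; exists l.
pose G : set LT := `]nu r, b[%classic.
have mG : measurable G by exact: measurable_itvo.
have GD : G `<=` D.
  move=> s; rewrite /G/= in_itv/= => /andP[ns sb]; apply/andP; split.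
    by apply: lt_trans n0 _; rewrite lte_fin.
  by apply: lt_le_trans bL; rewrite lte_fin.
have Goo : leb G < +oo.
  by rewrite leb_itv/=; case: ifP => _; rewrite -?EFinB ltry.
have [c c0 bc] := ri_norm_indic_scaled hX mG GD Goo.
pose g (t : LT) := c%:E * (\1_G t : R)%:E.
have [g0 _] := bc; have [mg _] := g0.
have mgv (a : R) : (0 <= a)%R -> measurable_fun (oitv a L : set LT) (fun s => `|g s| * (v s)%:E).
  move=> a0; apply: measurable_funS (measurable_Hop_body mg); first exact: measurable_oitv.
  exact: oitv_sub.
have I0 : 0 < \int[leb]_(s in (oitv (nu r) L : set LT)) (`|g s| * (v s)%:E).
  have GS : G `<=` oitv (nu r) L.
    move=> s Gs; have /andP[_ sL] := GD s Gs; apply/andP; split => //.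
    by move: Gs; rewrite /G/= in_itv/= lte_fin => /andP[].
  apply: (@lt_le_trans _ _ (\int[leb]_(s in G) (`|g s| * (v s)%:E))); last first.
    apply: ge0_subset_integral.
    - exact: mG.
    - exact: measurable_oitv.
    - by apply: mgv; exact: nu_ge0.
    - by move=> s /(oitv_sub (nu_ge0 Dr)); exact: Hop_body_ge0.
    - exact: GS.
  apply: integral_gt0.
  - exact: mG.
  - apply: measurable_funS (measurable_Hop_body mg) => //; exact: measurable_oitv.
  - move=> s Gs; rewrite /g indicE mem_set// mule1 gee0_abs ?lee_fin ?ltW//.
    by rewrite -EFinM lte_fin mulr_gt0// v_gt0//; exact: GD.
  - by change (0 < leb G); rewrite leb_itv/= lte_fin nb -EFinB lte_fin subr_gt0.
have Hr : 0 < H g r.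
  by rewrite /Hop mule_gt0// lte_fin u_gt0.
have [d d0 dH] : exists2 d : R, (0 < d)%R & d%:E < H g r.
  case: (H g r) Hr => [y| |]//; last by exists 1%R; rewrite ?ltry.
  by rewrite lte_fin => y0; exists (y / 2)%R; rewrite ?lte_fin; lra.
exists g, d; split => // s Ds sr.
by apply: (lt_le_trans dH); apply: Hop_nonincreasing.
Qed.

Lemma range_hull_indic (E : set LT) : measurable E -> E `<=` D -> leb E < +oo ->
  leb E < L -> exists2 c : R, (0 < c)%R & range_hull (fun t => c%:E * (\1_E t)%:E).
Proof.
move=> mE ED Eoo EL; have E0 := @mfuns_ge0_indic R L E mE.
(* r has to be an interior point: |E| itself might be 0, in which case the point of nondegeneracy
   serves. *)
have [r Dr Er] : exists2 r : R, D r & leb E <= r%:E.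
  have Efin : leb E \is a fin_num by rewrite ge0_fin_numE.
  have [t0 Dt0 _] := u_nondeg.
  have [Et|tE] := leP (leb E) t0%:E; first by exists t0.
  exists (fine (leb E)); rewrite ?(fineK Efin)//.
  rewrite /oitv/= (fineK Efin) EL andbT; apply: lt_trans tE.
  by have /andP[] := Dt0.
have [g [c [bg c0 Hc]]] := Hop_gt_indic Dr; exists c => //.
split; first exact: (mfuns_ge0_scale (ltW c0) E0).
exists g => // l l0.
rewrite -!superlevelE superlevel_scaled_indic ?(ltW c0) ?(ltW l0)//.
case: ifPn => [lc|_]; last by rewrite measure0.
apply: (le_trans Er); have /andP[r0 rL] := Dr.
rewrite -[leLHS](leb_oitv (ltW r0)); apply: le_measure; rewrite ?inE.
- exact: measurable_oitv.
- by have [[mg _] _] := bg; apply: measurable_superlevel; case: (mfuns_ge0_Hop mg).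
- move=> s /andP[s0 sr]; have Ds : D s by apply/andP; split => //; exact: lt_trans rL.
  split => //=; rewrite gee0_abs ?Hop_ge0//; rewrite lte_fin in sr.
  by apply: lt_trans (Hc s Ds (ltW sr)); rewrite lte_fin.
Qed.

Let w t : \bar R := (v t)%:E * U (inv t).

Lemma measurable_w : measurable_fun D (w : LT -> \bar R).
Proof.
apply: emeasurable_funM; first exact: measurable_v.
apply: measurable_nondecreasing; first exact: oitv_interval.
by move=> x y Dx Dy xy; apply: weight_int_le; [exact: inv_in|exact: inv_le].
Qed.

Lemma w_ge0 t : D t -> 0 <= w t.
Proof.
move=> Dt; rewrite mule_ge0//; first by rewrite lee_fin ltW// v_gt0.
by apply: weight_int_ge0; exact: inv_in.
Qed.

Lemma xi_lty t : L != +oo -> xi L u v nu t = w t.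
Proof. by rewrite /xi; case: ifP. Qed.

Lemma xi_small t : L = +oo -> (0 < t < 1)%R -> xi L u v nu t = w t.
Proof.
move=> Loo /andP[t0 t1]; rewrite /xi Loo eqxx !indicE.
rewrite mem_set; last by rewrite /= in_itv/= t0.
rewrite memNset; last by rewrite /= in_itv/= andbT; apply/negP; rewrite -leNgt ltW.
by rewrite mule1 mulr0 adde0 -Loo.
Qed.

Lemma xi_large t : L = +oo -> (1 < t)%R -> xi L u v nu t = (v t)%:E.
Proof.
move=> Loo t1; rewrite /xi Loo eqxx !indicE.
rewrite memNset; last by rewrite /= in_itv/=; apply/negP; rewrite negb_and -!leNgt (ltW t1) orbT.
rewrite mem_set; last by rewrite /= in_itv/= andbT.
by rewrite mule0 mulr1 add0e.
Qed.

Lemma mfuns_ge0_xi : mfuns_ge0 L (xi L u v nu).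
Proof.
have [Loo|Loo] := eqVneq L +oo; last first.
  rewrite (_ : xi L u v nu = w); last by apply/funext => t; rewrite xi_lty.
  by apply: mfuns_ge0_of; [exact: measurable_w|exact: w_ge0].
have xiE : xi L u v nu = fun t => w t * (\1_(`]0%R, 1%R[%classic : set R) t)%:E
    + (v t * \1_(`]1%R, +oo[%classic : set R) t)%:E.
  by apply/funext => t; rewrite /xi Loo eqxx -Loo.
rewrite xiE; apply: mfuns_ge0_of => [|t Dt]; last first.
  apply: adde_ge0; first by apply: mule_ge0; [exact: w_ge0|rewrite lee_fin].
  by rewrite lee_fin; apply: mulr_ge0 => //; exact: ltW (v_gt0 Dt).
apply: emeasurable_funD.
  apply: emeasurable_funM; first exact: measurable_w.
  exact: (@measurable_eindic _ LT R _ _ (measurable_itvo 0 1)).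
apply/measurable_EFinP; apply: measurable_funM => //.
apply: (@measurable_indic _ LT R).
by apply: measurable_interval; exact: interval_is_interval.
Qed.

(** For L = oo both indicators in [xi] vanish at 1, so the comparisons with [xi] are made off this
    point. *)
Lemma ae_neq1 : \forall t \ae @leb R, t <> 1%R.
Proof.
exists (`[1%R, 1%R]%classic : set LT); split.
- by apply: measurable_interval; exact: interval_is_interval.
- by change (leb (`[1%R, 1%R]%classic : set LT) = 0); rewrite leb_itv/= ltxx.
- by move=> t /= /contrapT ->; rewrite /= in_itv/= lexx.
Qed.

(** The rearrangement of the indicator is at most 1 and vanishes from |E| on. So the integral in
    [dual_op] is bounded by U(nu^-1(t)), used for t < 1 or L finite, and by the constant U(e) with e
    >= |E|, used for t > 1. *)
Lemma target_indic_lty (E : set LT) : X' (xi L u v nu) < +oo ->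
  measurable E -> E `<=` D -> leb E < +oo -> target (fun t => (\1_E t)%:E) < +oo.
Proof.
move=> xi_oo mE ED Eoo.
have xi0 := mfuns_ge0_xi; have dual0 := mfuns_ge0_dual_op (fun t => (\1_E t : R)%:E).
have [Loo|Loo] := eqVneq L +oo; last first.
  apply: le_lt_trans xi_oo; apply: (rin_le riX' dual0 xi0); apply: nearW => t Dt.
  by rewrite xi_lty//; exact: dual_op_indic_le.
have Efin : leb E \is a fin_num by rewrite ge0_fin_numE.
(* The 1 puts e inside (0, oo) even for a null set. *)
pose e : R := (fine (leb E) + 1)%R.
have fE0 : (0 <= fine (leb E))%R by rewrite fine_ge0.
have De : D e by apply/andP; rewrite Loo ltry lte_fin; split => //; rewrite ltr_wpDl.
have Ee : leb E <= e%:E by rewrite -(fineK Efin) lee_fin lerDl.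
have Ufin : U e \is a fin_num by rewrite ge0_fin_numE ?weight_int_lty ?weight_int_ge0.
pose c : R := (1 + fine (U e))%R.
have U0 : (0 <= fine (U e))%R by apply: fine_ge0; exact: weight_int_ge0.
have c0 : (0 <= c)%R by rewrite /c; lra.
apply: (@le_lt_trans _ _ (c%:E * X' (xi L u v nu))); last by rewrite lte_mul_pinfty ?lee_fin//.
rewrite -(rin_scale riX' c0 xi0).
apply: (rin_le riX' dual0 (mfuns_ge0_scale c0 xi0)).
apply: filterS ae_neq1 => t t1 Dt; have /andP[t0 _] := Dt; rewrite lte_fin in t0.
have [tl|tg|//] := ltgtP (t : R) 1%R.
  rewrite xi_small ?t0//; apply: (le_trans (dual_op_indic_le mE ED Dt)).
  rewrite -[leLHS]mul1e; apply: lee_wpmul2r; first exact: w_ge0.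
  by rewrite lee_fin /c; lra.
rewrite xi_large//; apply: (le_trans (dual_op_indic_le_cst mE ED Dt De Ee)).
rewrite muleC; apply: lee_wpmul2r; first by rewrite lee_fin ltW// v_gt0.
by rewrite -(fineK Ufin) lee_fin /c; lra.
Qed.

(** One set suffices: (0, L) itself if L is finite, otherwise (0, e) with e = nu^-1(1). For the
    latter [dual_op] of the indicator dominates v U(nu^-1) on t < 1 and v U(e) on t > 1, whence the
    factor 1 + 1 / U(e). *)
Lemma xi_lty_target : (forall E : set LT, measurable E -> E `<=` D -> leb E < +oo ->
  target (fun t => (\1_E t)%:E) < +oo) -> X' (xi L u v nu) < +oo.
Proof.
move=> target_oo; have xi0 := mfuns_ge0_xi.
have [Loo|Loo] := eqVneq L +oo; last first.
  have lebD : leb D = L by apply: leb_oitv; exact: ltW.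
  have mD : measurable D by exact: measurable_oitv.
  have Doo : leb D < +oo by rewrite lebD ltey.
  apply: le_lt_trans (target_oo D mD (@subset_refl _ _) Doo).
  apply: (rin_le riX' xi0 (mfuns_ge0_dual_op _)); apply: nearW => t Dt.
  rewrite xi_lty//; apply: dual_op_indic_ge => //.
  by rewrite lebD ltW//; have /andP[] := inv_in Dt.
have D1 : D 1%R by apply/andP; rewrite Loo ltry lte_fin.
pose e := inv 1%R; have De : D e := inv_in D1.
have /andP[e0 eL] := De.
pose E : set LT := oitv 0 e%:E.
have lebE : leb E = e%:E by apply: leb_oitv; exact: ltW.
have mE : measurable E by exact: measurable_oitv.
have ED : E `<=` D by move=> s /andP[s0 se]; apply/andP; split => //; exact: lt_trans eL.
have Eoo : leb E < +oo by rewrite lebE ltry.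
have Ufin : U e \is a fin_num by rewrite ge0_fin_numE ?weight_int_lty ?weight_int_ge0.
have U0 : (0 < fine (U e))%R by rewrite -lte_fin (fineK Ufin) weight_int_gt0.
have Ui0 : (0 <= (fine (U e))^-1)%R by rewrite invr_ge0 ltW.
pose c : R := (1 + (fine (U e))^-1)%R.
have c0 : (0 <= c)%R by rewrite /c; lra.
have dual0 := mfuns_ge0_dual_op (fun t => (\1_E t : R)%:E).
apply: (@le_lt_trans _ _ (c%:E * target (fun t => (\1_E t)%:E))); last first.
  by rewrite lte_mul_pinfty ?lee_fin// target_oo.
have -> : c%:E * target (fun t => (\1_E t)%:E) =
    X' (fun t => c%:E * dual_op (fun t => (\1_E t : R)%:E) t).
  by rewrite (rin_scale riX' c0 dual0).
apply: (rin_le riX' xi0 (mfuns_ge0_scale c0 dual0)).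
apply: filterS ae_neq1 => t t1 Dt; have /andP[t0 _] := Dt; rewrite lte_fin in t0.
have dual_t0 : 0 <= dual_op (fun t => (\1_E t : R)%:E) t.
  rewrite mule_ge0//; first by rewrite lee_fin ltW// v_gt0.
  by apply: integral_ge0 => s /(itv_sub (inv_in Dt)); exact: rearr_u_ge0.
have [tl|tg|//] := ltgtP (t : R) 1%R.
  rewrite xi_small ?t0//; apply: (@le_trans _ _ (1 * dual_op (fun t => (\1_E t : R)%:E) t)).
    rewrite mul1e; apply: dual_op_indic_ge => //; rewrite lebE lee_fin.
    by apply: inv_le => //; exact: ltW.
  by apply: lee_wpmul2r => //; rewrite lee_fin /c; lra.
rewrite xi_large//.
have vU : (v t)%:E * U e <= dual_op (fun t => (\1_E t : R)%:E) t.
  by apply: dual_op_indic_ge; rewrite ?lebE//; apply: inv_le => //; exact: ltW.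
apply: (@le_trans _ _ ((fine (U e))^-1%:E * dual_op (fun t => (\1_E t : R)%:E) t)).
  by rewrite lee_pdivlMl// muleC (fineK Ufin).
by apply: lee_wpmul2r => //; rewrite lee_fin /c; lra.
Qed.

Lemma target_ri_norm : X' (xi L u v nu) < +oo -> ri_norm L (polar L range_hull).
Proof.
move=> xi_oo; apply: (polar_ri_norm L0 range_hull_solid _ range_hull_indic) => E mE ED Eoo.
rewrite -target_polar; first exact: target_indic_lty.
exact: mfuns_ge0_indic.
Qed.

Lemma target_norm_exists : X' (xi L u v nu) < +oo ->
  exists2 NY, ri_norm L NY &
    forall f, mfuns_ge0 L f -> assoc_norm L NY f = target f.
Proof.
move=> xi_oo; have riT := target_ri_norm xi_oo.
exists (assoc_norm L (polar L range_hull)); first exact: assoc_norm_ri_norm.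
move=> f f0; rewrite target_polar//; apply/eqP; rewrite eq_le; apply/andP; split.
  apply: polar_le => g [g0 Ng]; rewrite -[leRHS]mul1e.
  exact: (holder_assoc riT ltr01 f0 g0 Ng).
(* An element of the hull lies in the unit ball of the associate of the hull's polar, by the
   definition of the polar. *)
apply: polar_le => h Sh; apply: polar_ub; split; first exact: (rs_mfuns range_hull_solid Sh).
by apply: polar_le => k [k0 Nk]; rewrite integral_mulC; apply: le_trans Nk; exact: polar_ub.
Qed.

Lemma bounded_op_target NY : ri_norm L NY ->
  (forall f, mfuns_ge0 L f -> assoc_norm L NY f = target f) -> bounded_op L H NX NY.
Proof.
move=> riY NY'; exists 1%R => // g mg; rewrite mul1e /ext_norm.
have g0 := mfuns_ge0_abs mg; have Hg0 := mfuns_ge0_Hop mg; have [mH _] := Hg0.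
rewrite (ri_norm_abs riY Hg0); apply: (le_trans (lorentz_luxemburg L0 riY Hg0)).
apply: polar_le => k [k0 Nk]; have [mk _] := k0.
rewrite NY'// in Nk.
rewrite integral_mulC; apply: (le_trans (integral_mul_pairing k0 Hg0)).
rewrite -(Hop_abs g) -(dual_op_duality mk g0).
set n := NX _; have n0 : 0 <= n by exact: (rin_ge0 hX g0).
have [noo|noo] := eqVneq n +oo; first by rewrite noo leey.
have nfin : n \is a fin_num by rewrite ge0_fin_numE// ltey.
(* Enlarging the norm of g by e > 0 permits division even when it is 0. *)
apply/lee_addgt0Pr => e e0; rewrite -(fineK nfin) -EFinD.
pose a : R := (fine n + e)%R.
have a0 : (0 < a)%R by rewrite /a ltr_wpDl// fine_ge0.
have ai0 : (0 <= a^-1)%R by rewrite invr_ge0 ltW.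
have bg : ball (fun x => (a^-1)%:E * `|g x|).
  split; first exact: mfuns_ge0_scale.
  rewrite (rin_scale hX ai0 g0) -/n -(fineK nfin) -EFinM lee_fin mulrC ler_pdivrMr//.
  by rewrite mul1r /a lerDl ltW.
have := le_trans (polar_ub L (dual_op k) bg) Nk.
rewrite integral_mulC (integral_mulZ ai0 g0 (mfuns_ge0_dual_op k)) integral_mulC.
by rewrite lee_pdivrMl// mule1.
Qed.

(** The dual form of boundedness into Z. Resonance replaces H g by functions h dominated by it in
    distribution, whose Z-norm is no larger, so that Hoelder applies to k and h. It serves both
    optimality and the necessity of the condition on xi. *)
Lemma target_le_of_bounded NZ (C : R) k : ri_norm L NZ -> (0 < C)%R ->
  (forall f, mfuns L f -> ext_norm NZ (H f) <= C%:E * ext_norm NX f) ->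
  mfuns_ge0 L k -> forall B : R, (0 < B)%R -> assoc_norm L NZ k <= B%:E ->
  target k <= (B * C)%:E.
Proof.
move=> riZ C0 HC k0 B B0 Nk; have [mk _] := k0.
apply: polar_le => g [g0 Ng]; have [mg _] := g0.
have Hg0 := mfuns_ge0_Hop mg; have [mH _] := Hg0.
rewrite dual_op_duality//; apply: resonance => // h mh h0 hH.
have hM : mfuns_ge0 L h by apply: mfuns_ge0_of.
rewrite -(integral_mulabs k0 hM) integral_mulC.
apply: (le_trans (holder_assoc riZ B0 hM k0 Nk)).
rewrite EFinM; apply: lee_wpmul2l; first by rewrite lee_fin ltW.
apply: (le_trans (ri_norm_distr_le L0 riZ hM Hg0 hH)).
rewrite -(ri_norm_abs riZ Hg0); apply: (le_trans (HC g mg)).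
rewrite /ext_norm (ri_norm_abs hX g0) -[leRHS]mule1.
by apply: lee_wpmul2l => //; rewrite lee_fin ltW.
Qed.

Lemma embedded_target NY NZ : ri_norm L NY ->
  (forall f, mfuns_ge0 L f -> assoc_norm L NY f = target f) ->
  ri_norm L NZ -> bounded_op L H NX NZ -> embedded L NY NZ.
Proof.
move=> riY NY' riZ [C C0 HC]; exists C => // f mf; have f0 := mfuns_ge0_abs mf.
apply: (le_trans (lorentz_luxemburg L0 riZ f0)).
apply: polar_le => k [k0 Nk]; apply: holder_assoc => //.
by rewrite NY'// -[C]mul1r; exact: target_le_of_bounded HC k0 _ _ Nk.
Qed.

(** Z' is finite on indicators by (P4), hence so is the target functional, and [xi] is controlled by
    one such indicator. *)
Lemma xi_lty_of_bounded NZ : ri_norm L NZ -> bounded_op L H NX NZ ->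
  X' (xi L u v nu) < +oo.
Proof.
move=> riZ [C C0 HC]; apply: xi_lty_target => E mE ED Eoo.
have E0 := @mfuns_ge0_indic R L E mE.
have Z'ri := assoc_norm_ri_norm L0 riZ.
have Zlt := rin_indic_fin Z'ri mE ED Eoo; have Z0 := rin_ge0 Z'ri E0.
have Zfin : assoc_norm L NZ (fun t => (\1_E t)%:E) \is a fin_num by rewrite ge0_fin_numE.
pose B : R := (fine (assoc_norm L NZ (fun t => (\1_E t)%:E)) + 1)%R.
have B0 : (0 < B)%R by rewrite /B ltr_wpDl// fine_ge0.
apply: (@le_lt_trans _ _ (B * C)%:E); last by rewrite ltry.
apply: (target_le_of_bounded riZ C0 HC E0 B0).
by rewrite -(fineK Zfin) lee_fin /B lerDl.
Qed.

Lemma in_space_xi : in_space L X' (xi L u v nu) <-> X' (xi L u v nu) < +oo.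
Proof.
have xi0 := mfuns_ge0_xi; rewrite /in_space /ext_norm (ri_norm_abs riX' xi0).
by split => [[]//|xi_oo]; split => //; case: xi0.
Qed.

End weighted_operator.

Local Close Scope ereal_scope.

(** [ri_norm] constrains a functional only on [mfuns_ge0], so Y is determined only there.
    Accordingly, a norm with the prescribed associate norm is shown to exist, and every such norm is
    shown to be optimal. *)
Theorem proposition3p4 (R : realType) (L : \bar R) (hL : (0 < L)%E)
    (NX : (lebesgueType R -> \bar R) -> \bar R) (hX : ri_norm L NX)
    (nu : R -> R) (nu_bij : set_bij (oitv 0 L) (oitv 0 L) nu)
    (nu_incr : {in oitv 0 L &, {homo nu : s t / s < t}})
    (u : R -> R) (u_gt0 : forall t, oitv 0 L t -> 0 < u t)
    (u_nondeg : nondeg_weight L u)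
    (u_noninc : {in oitv 0 L &, {homo u : s t / s <= t >-> s >= t}})
    (u_lim : forall l : R, L = l%:E -> 0 < lim (u t @[t --> l^'-]))
    (v : R -> R) (v_gt0 : forall t, oitv 0 L t -> 0 < v t)
    (v_meas : measurable_fun (oitv 0 L : set (lebesgueType R))
                (v : lebesgueType R -> R)) :
  (in_space L (assoc_norm L NX) (xi L u v nu) ->
     (exists2 NY, ri_norm L NY &
        forall f, mfuns_ge0 L f ->
          assoc_norm L NY f = target_assoc_norm L u v nu NX f) /\
     (forall NY, ri_norm L NY ->
        (forall f, mfuns_ge0 L f ->
          assoc_norm L NY f = target_assoc_norm L u v nu NX f) ->
        optimal_target L (Hop L u v nu) NX NY)) /\
  (~ in_space L (assoc_norm L NX) (xi L u v nu) ->
     ~ exists2 NZ, ri_norm L NZ & bounded_op L (Hop L u v nu) NX NZ).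
Proof.
have xi_in : in_space L (assoc_norm L NX) (xi L u v nu) <->
    (assoc_norm L NX (xi L u v nu) < +oo)%E by exact: in_space_xi.
split=> [/xi_in xi_oo|xi_notin [NZ riZ bZ]]; last first.
  apply: xi_notin; apply/xi_in.
  exact: (xi_lty_of_bounded hL nu_bij nu_incr u_gt0 u_nondeg u_noninc v_gt0 v_meas
    hX riZ bZ).
split; first exact: target_norm_exists.
move=> NY riY NY'; split=> [//||NZ riZ bZ].
  exact: (bounded_op_target hL nu_bij nu_incr u_gt0 u_noninc v_gt0 v_meas hX riY NY').
exact: (embedded_target hL nu_bij nu_incr u_gt0 u_noninc v_gt0 v_meas hX riY NY'
  riZ bZ).
Qed.
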